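(* For a matrix $A\in\mathrm{GL}(\mathbb R^2)$ all eight first angular values $\check\theta_{[1]}(A),\check\theta_1(A),\hat\theta_1(A),\hat\theta_{[1]}(A),\underline\theta_{[1]}(A),\underline\theta_1(A),\bar\theta_1(A),\bar\theta_{[1]}(A)$ coincide; denote the common value by $\theta_1(A)$. Moreover, the following holds: (a) If $A$ has only real eigenvalues then $$\theta_1(A)=\begin{cases}\frac\pi2,&\text{if }\sigma(A)=\{-\lambda,\lambda\}\subset\mathbb R,\ \lambda>0,\\ 0,&\text{otherwise.}\end{cases}$$ (b) If $\sigma(A)=\{\lambda,\bar\lambda\}$ with $\mathrm{Im}(\lambda)\ne0$, then $$\theta_1(A)\le\min(|\arg(\lambda)|,\pi-|\arg(\lambda)|).$$ If additionally $\mathrm{skew}(A)\le1$, then equality holds, i.e. $\theta_1(A)=\min(|\arg(\lambda)|,\pi-|\arg(\lambda)|)$.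
   Context: $\sigma(A)$ is the spectrum of $A$; $\arg(\lambda)\in(-\pi,\pi]$. The skewness is $\mathrm{skew}(A)=\frac1{2r(A)}\|A-A^\top\|$, with $\|\cdot\|$ the spectral norm and $r(A)=\max\{|\lambda|:\lambda\in\sigma(A)\}$. $\mathcal G(1,2)$ is the set of one-dimensional subspaces of $\mathbb R^2$, and for $V=\mathrm{span}(v)$, $W=\mathrm{span}(w)$, $\measuredangle(V,W)=\arccos\frac{|v^\top w|}{\|v\|\|w\|}\in[0,\frac\pi2]$. For $V\in\mathcal G(1,2)$, $n\in\mathbb N$, $k\in\mathbb N_0$ let $a_{k+1,k+n}(V)=\sum_{j=k+1}^{k+n}\measuredangle(A^{j-1}V,A^jV)$. With suprema over $V\in\mathcal G(1,2)$, the first angular values of $A$ are: inner: $\bar\theta_1=\limsup_{n\to\infty}\frac1n\sup_Va_{1,n}(V)$, $\underline\theta_1=\liminf_{n\to\infty}\frac1n\sup_Va_{1,n}(V)$; outer: $\hat\theta_1=\sup_V\limsup_{n\to\infty}\frac1na_{1,n}(V)$, $\check\theta_1=\sup_V\liminf_{n\to\infty}\frac1na_{1,n}(V)$; uniform inner: $\bar\theta_{[1]}=\limsup_{n\to\infty}\frac1n\sup_V\sup_{k\in\mathbb N_0}a_{k+1,k+n}(V)$, $\underline\theta_{[1]}=\liminf_{n\to\infty}\frac1n\sup_V\inf_{k\in\mathbb N_0}a_{k+1,k+n}(V)$; uniform outer: $\hat\theta_{[1]}=\sup_V\lim_{n\to\infty}\frac1n\sup_{k\in\mathbb N_0}a_{k+1,k+n}(V)$,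 $\check\theta_{[1]}=\sup_V\lim_{n\to\infty}\frac1n\inf_{k\in\mathbb N_0}a_{k+1,k+n}(V)$ (the limits exist by Fekete's lemma). *)

(* Defs.v *)
From HB Require Import structures.
From mathcomp Require Import all_boot all_order all_algebra.
From mathcomp Require Import all_classical all_reals all_analysis.
From mathcomp Require Import complex.

Set Implicit Arguments.
Unset Strict Implicit.
Unset Printing Implicit Defensive.

Import Order.TTheory GRing.Theory Num.Theory.
Import numFieldNormedType.Exports.

Local Open Scope classical_set_scope.
Local Open Scope ring_scope.

Section Spectrum.
Variable R : realType.
Local Open Scope complex_scope.

Definition cabs (z : R[i]) : R := Num.sqrt (complex.Re z ^+ 2 + complex.Im z ^+ 2).

(* The argument in ]-pi, pi] of z != 0; see [cargP].  At z = 0 the value is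
   pi / 2, which is of no significance. *)
Definition carg (z : R[i]) : R :=
  if 0 <= complex.Im z then acos (complex.Re z / cabs z)
  else - acos (complex.Re z / cabs z).

(* The library's [eigenvalue] refers to left eigenvectors (v *m A = l *: v);
   A and A^T have the same eigenvalues. *)
Definition spectrum n (A : 'M[R]_n) : set R[i] :=
  [set l | eigenvalue (map_mx (real_complex R) A) l].

Definition spectral_radius n (A : 'M[R]_n) : R := sup [set cabs l | l in spectrum A].

End Spectrum.

Section Euclidean.
Variable R : realType.

Definition dot n (v w : 'cV[R]_n) : R := (v^T *m w) 0 0.

(* The norm of 'cV[R]_n provided by the library is the max norm. *)
Definition norm2 n (v : 'cV[R]_n) : R := Num.sqrt (dot v v).

Definition spectral_norm n (A : 'M[R]_n) : R :=
  sup [set norm2 (A *m v) | v in [set v : 'cV[R]_n | norm2 v = 1]].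

Definition skewness n (A : 'M[R]_n) : R :=
  (2 * spectral_radius A)^-1 * spectral_norm (A - A^T).

Definition Gr12 : set {vspace 'cV[R]_2} := [set V | \dim V = 1%N].

(* [vpick V] is some nonzero vector of V; the angle does not depend on its
   choice, see [angle_line]. *)
Definition angle (V W : {vspace 'cV[R]_2}) : R :=
  acos (`|dot (vpick V) (vpick W)| / (norm2 (vpick V) * norm2 (vpick W))).

Definition mx_image (A : 'M[R]_2) (V : {vspace 'cV[R]_2}) : {vspace 'cV[R]_2} :=
  (linfun (mulmx A) @: V)%VS.

(* a_{k+1,k+n}(V) *)
Definition angle_sum (A : 'M[R]_2) (k n : nat) (V : {vspace 'cV[R]_2}) : R :=
  \sum_(k.+1 <= j < (k + n).+1)
    angle (mx_image (A ^+ j.-1) V) (mx_image (A ^+ j) V).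

End Euclidean.

(* All angle sums lie in [0, n * pi / 2], so the real-valued [sup], [inf],
   [limn_sup] and [limn_inf] below are the usual ones, and the [limn] exist by
   Fekete's lemma. *)
Section AngularValues.
Variables (R : realType) (A : 'M[R]_2).

Definition supV (f : {vspace 'cV[R]_2} -> R) : R := sup [set f V | V in @Gr12 R].

Definition supk (f : nat -> R) : R := sup (range f).
Definition infk (f : nat -> R) : R := inf (range f).

Definition inner_sup : R :=
  limn_sup (fun n => n%:R^-1 * supV (angle_sum A 0 n)).
Definition inner_inf : R :=
  limn_inf (fun n => n%:R^-1 * supV (angle_sum A 0 n)).

Definition outer_sup : R :=
  supV (fun V => limn_sup (fun n => n%:R^-1 * angle_sum A 0 n V)).
Definition outer_inf : R :=
  supV (fun V => limn_inf (fun n => n%:R^-1 * angle_sum A 0 n V)).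

Definition uniform_inner_sup : R :=
  limn_sup (fun n => n%:R^-1 * supV (fun V => supk (fun k => angle_sum A k n V))).
Definition uniform_inner_inf : R :=
  limn_inf (fun n => n%:R^-1 * supV (fun V => infk (fun k => angle_sum A k n V))).

Definition uniform_outer_sup : R :=
  supV (fun V => limn (fun n => n%:R^-1 * supk (fun k => angle_sum A k n V))).
Definition uniform_outer_inf : R :=
  supV (fun V => limn (fun n => n%:R^-1 * infk (fun k => angle_sum A k n V))).

End AngularValues.

Section Sanity.
Variable R : realType.

Lemma normr_div_sqrt_le1 (x y : R) : x ^+ 2 + y ^+ 2 != 0 ->
  -1 <= x / Num.sqrt (x ^+ 2 + y ^+ 2) <= 1.
Proof.
move=> h; have s0 : 0 < Num.sqrt (x ^+ 2 + y ^+ 2).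
  by rewrite sqrtr_gt0 lt_def h addr_ge0 ?sqr_ge0.
rewrite -ler_norml normrM normfV (gtr0_norm s0) ler_pdivrMr// mul1r.
by rewrite -sqrtr_sqr ler_wsqrtr// lerDl sqr_ge0.
Qed.

Lemma cargP (z : R[i]) : z != 0 ->
  [/\ - pi < carg z <= pi, complex.Re z = cabs z * cos (carg z) &
      complex.Im z = cabs z * sin (carg z)].
Proof.
case: z => x y; rewrite /carg /cabs eq_complex/= => z0.
have h : x ^+ 2 + y ^+ 2 != 0.
  by rewrite paddr_eq0 ?sqr_ge0// !expf_eq0.
have s0 : 0 < Num.sqrt (x ^+ 2 + y ^+ 2).
  by rewrite sqrtr_gt0 lt_def h addr_ge0 ?sqr_ge0.
have := normr_div_sqrt_le1 h.
set s := Num.sqrt _ in s0 * => b.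
have ss : s ^+ 2 = x ^+ 2 + y ^+ 2 by rewrite sqr_sqrtr// addr_ge0 ?sqr_ge0.
have [a0 ap] := (acos_ge0 b, acos_lepi b).
have cE : cos (acos (x / s)) = x / s by rewrite acosK.
have sE : s * sin (acos (x / s)) = `|y|.
  rewrite sin_acos// -[X in X * _](gtr0_norm s0) -sqrtr_sqr -sqrtrM ?sqr_ge0//.
  rewrite mulrBr mulr1 -exprMn mulrCA divff ?gt_eqF// mulr1 ss.
  by rewrite addrAC subrr add0r sqrtr_sqr.
case: ifPn => [y0|]; last rewrite -ltNge => y0.
  split; rewrite ?cE ?sE ?ger0_norm//.
  - by rewrite ap (lt_le_trans _ a0)// oppr_lt0 pi_gt0.
  - by rewrite mulrCA divff ?gt_eqF// mulr1.
split; rewrite ?cosN ?sinN ?cE ?mulrN ?sE ?ltr0_norm ?opprK//.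
- have xs1 : -1 < x / s.
    rewrite lt_neqAle (andP b).1 andbT; apply/eqP => e.
    move: ss; rewrite -[x](@divfK _ s) ?gt_eqF// -e mulN1r sqrrN -[LHS]addr0.
    by move/addrI/esym/eqP; rewrite sqrf_eq0 lt_eqF.
  rewrite ltrN2 acos_ltpi ?xs1 ?(andP b).2//=.
  by rewrite (le_trans _ (pi_ge0 R))// oppr_le0.
- by rewrite mulrCA divff ?gt_eqF// mulr1.
Qed.

Lemma dotZ n a b (v w : 'cV[R]_n) : dot (a *: v) (b *: w) = a * b * dot v w.
Proof. by rewrite /dot [(a *: v)^T]linearZ/= -scalemxAl -scalemxAr scalerA mxE. Qed.

Lemma norm2Z n a (v : 'cV[R]_n) : norm2 (a *: v) = `|a| * norm2 v.
Proof. by rewrite /norm2 dotZ sqrtrM -?expr2 ?sqr_ge0// sqrtr_sqr. Qed.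

Lemma vpick_line (v : 'cV[R]_2) : v != 0 ->
  exists2 a, a != 0 & vpick <[v]>%VS = a *: v.
Proof.
move=> v0; have /vlineP[a aE] := memv_pick <[v]>%VS; exists a => //.
apply: contraNneq v0 => a0; have := vpick0 <[v]>%VS.
by rewrite aE a0 scale0r eqxx => /esym/eqP l0; rewrite -memv0 -l0 memv_line.
Qed.

Lemma angle_line (v w : 'cV[R]_2) : v != 0 -> w != 0 ->
  angle <[v]> <[w]> = acos (`|dot v w| / (norm2 v * norm2 w)).
Proof.
move=> /vpick_line[a a0 vE] /vpick_line[b b0 wE].
rewrite /angle vE wE dotZ !norm2Z !normrM; congr acos.
by rewrite mulrACA invfM mulrACA divff ?mul1r// mulf_neq0 ?normr_eq0.
Qed.

Lemma mx_image_line (A : 'M[R]_2) v : mx_image A <[v]> = <[A *m v]>%VS.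
Proof. by rewrite /mx_image limg_line lfunE. Qed.

End Sanity.

(* Main.v *)
Require Import Defs.
From HB Require Import structures.
From mathcomp Require Import all_boot all_order all_algebra.
From mathcomp Require Import all_classical all_reals all_analysis.
From mathcomp Require Import complex.
From mathcomp Require Import ring lra.

Import Order.TTheory GRing.Theory Num.Theory.
Import numFieldNormedType.Exports.

Local Open Scope classical_set_scope.
Local Open Scope ring_scope.

(** The eight angular values differ only in the order of limits, suprema and
    infima, so they coincide as soon as the mean angles
    [n^-1 a_{k+1,k+n}(V)] converge, uniformly in the line [V] and in the
    starting time [k], to some [m V] ([uniform_mean], [angular_values_eq]); the
    common value is then the supremum of [m].  Let [t] and [d] be the trace and
    the determinant of [A].

    - If [t ^ 2 >= 4 d] and [t <> 0], the eigenvalues are real and either of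
      distinct moduli or equal.  Lines that are not fixed move from one
      eigendirection to another (or from the only one to itself), and each angle
      is dominated by the increment of a bounded potential.  The angle sums are
      then bounded uniformly ([hyperbolic_bounded], [parabolic_bounded]), and
      [m = 0].

    - If [t ^ 2 >= 4 d] and [t = 0], then [A ^ 2] is scalar, so all the angles
      along the orbit of [V] equal the angle from [V] to [A V].  Its maximum is
      [pi / 2] because the quadratic form of a traceless matrix has an isotropic
      vector ([traceless_mean], [traceless_supV]).

    - If [t ^ 2 < 4 d], there are a positive definite matrix [P] and an angle
      [phi] in [(0, pi)] such that [A] multiplies [P (cos u, sin u)] by a
      constant and advances [u] by [phi] ([elliptic_form]).  The oriented angle
      from [P (cos u, sin u)] to its successor is
      [turn u = phi + tilt (u + phi) - tilt u] with [tilt] bounded and periodic;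
      it lies in [(0, pi)], and the angle between the lines is
      [min (turn u) (pi - turn u)].  The sum of [turn] over [n] steps telescopes
      to [n phi + O(1)], so [m <= min phi (pi - phi)].  If the skewness is at
      most 1, the symmetric part of [A] is semidefinite, [cos (turn u)] has a
      constant sign, the minimum is always the same one of its two arguments,
      and equality holds ([elliptic_mean], [semidefinite_of_skew]).
      Uniform convergence of the means needs no distinction between rational and
      irrational [phi / pi]: up to a small error, [k phi] modulo [pi] takes only
      finitely many values, all reached by a fixed time, so the mean depends
      little on the starting time ([sum_step_shift]), which suffices
      ([shift_uniform_mean]). *)

(** * Suprema and limits of nearly equal families *)

Section Suprema.
Variable R : realType.

Lemma sup_close (T : Type) (D : set T) (f m : T -> R) (c e : R) :
  D !=set0 -> 0 < c -> has_ubound [set m x | x in D] ->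
  (forall x, D x -> `|c * f x - m x| <= e) ->
  `|c * sup [set f x | x in D] - sup [set m x | x in D]| <= e.
Proof.
move=> [x0 Dx0] c0 um H.
have fm x : D x -> f x <= c^-1 * (m x + e).
  move=> Dx; rewrite -(ler_pM2l c0) mulrA divff ?gt_eqF// mul1r -lerBlDl.
  exact: le_trans (ler_norm _) (H _ Dx).
have mf x : D x -> m x <= c * f x + e.
  move=> Dx; rewrite -lerBlDl; apply: le_trans (ler_norm _) _.
  by rewrite distrC; exact: H.
have mle x : D x -> m x <= sup [set m x | x in D].
  by move=> Dx; apply: ub_le_sup => //; exists x.
have fub : ubound [set f x | x in D] (c^-1 * (sup [set m x | x in D] + e)).
  move=> _ [x Dx <-]; apply: le_trans (fm _ Dx) _.
  by rewrite ler_pM2l ?invr_gt0// lerD2r mle.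
rewrite ler_distl; apply/andP; split.
- rewrite lerBlDr; apply: ge_sup; first by exists (m x0), x0.
  move=> _ [x Dx <-]; apply: le_trans (mf _ Dx) _.
  rewrite lerD2r ler_pM2l//; apply: ub_le_sup; last by exists x.
  by exists (c^-1 * (sup [set m x | x in D] + e)).
- rewrite -[leRHS]mul1r -[in leRHS](@divff _ c) ?gt_eqF// -mulrA ler_pM2l//.
  by apply: ge_sup => //; exists (f x0), x0.
Qed.

Lemma range_sup_close (f : nat -> R) (c e x : R) : 0 < c ->
  (forall k, `|c * f k - x| <= e) -> `|c * sup (range f) - x| <= e.
Proof.
move=> c0 H.
have rE : range (fun _ : nat => x) = [set x].
  by apply/seteqP; split=> [_ [k _ <-]//|_ ->]; exists 0%N.
have := @sup_close nat setT f (fun=> x) c e.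
rewrite rE sup1; apply => //.
by exists x => _ ->.
Qed.

Lemma range_inf_close (f : nat -> R) (c e x : R) : 0 < c ->
  (forall k, `|c * f k - x| <= e) -> `|c * inf (range f) - x| <= e.
Proof.
move=> c0 H; have -> : inf (range f) = - sup (range (fun k => - f k)).
  by rewrite /inf; congr (- sup _); apply: image_comp.
rewrite mulrN -opprD normrN -[x]opprK.
by apply: range_sup_close => // k; rewrite mulrN -opprD normrN.
Qed.

Lemma cvg_of_le (u : nat -> R) (l : R) :
  (forall e, 0 < e -> exists N, forall n, (N <= n)%N -> `|u n - l| <= e) ->
  u @ \oo --> l.
Proof.
move=> H; apply/cvgrPdist_le => e e0; have [N HN] := H e e0.
by exists N => // n /= Nn; rewrite distrC HN.
Qed.

End Suprema.

(** * Lines of the plane and their angles *)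

Section Lines.
Variable R : realType.
Implicit Type V : {vspace 'cV[R]_2}.

Lemma dot_ge0 n (v : 'cV[R]_n) : 0 <= dot v v.
Proof.
by rewrite /dot mxE sumr_ge0// => i _; rewrite mxE -expr2 sqr_ge0.
Qed.

Lemma dot_sqr_le (v w : 'cV[R]_2) : dot v w ^+ 2 <= dot v v * dot w w.
Proof.
rewrite /dot !mxE !big_ord_recl !big_ord0 !mxE !addr0.
set a := v _ _; set b := v _ _; set c := w _ _; set d := w _ _.
rewrite -subr_ge0; have -> : (a * a + b * b) * (c * c + d * d)
   - (a * c + b * d) ^+ 2 = (a * d - b * c) ^+ 2 by ring.
exact: sqr_ge0.
Qed.

Lemma cos_line_itv (v w : 'cV[R]_2) :
  0 <= `|dot v w| / (norm2 v * norm2 w) <= 1.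
Proof.
rewrite divr_ge0 ?mulr_ge0 ?sqrtr_ge0//=.
have [n0|n0] := eqVneq (norm2 v * norm2 w) 0; first by rewrite n0 invr0 mulr0.
rewrite ler_pdivrMr ?lt_def ?n0 ?mulr_ge0 ?sqrtr_ge0// mul1r.
by rewrite /norm2 -sqrtrM ?dot_ge0// -sqrtr_sqr ler_wsqrtr// dot_sqr_le.
Qed.

Lemma angle_itv (V W : {vspace 'cV[R]_2}) : 0 <= angle V W <= pi / 2.
Proof.
rewrite /angle; have /andP[c0 c1] := cos_line_itv (vpick V) (vpick W).
set c := _ / _ in c0 c1 *.
have cI : -1 <= c <= 1 by rewrite c1 (le_trans _ c0)// lerN10.
rewrite acos_ge0//= leNgt; apply/negP => h.
have : cos (acos c) < cos (pi / 2).
  by rewrite ltr_cos// in_itv/= ?acos_ge0 ?acos_lepi// divr_ge0 ?pi_ge0//=;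
    have := pi_ge0 R; lra.
by rewrite acosK ?in_itv/= ?cI// cos_pihalf ltNge c0.
Qed.

Lemma Gr12_line V : Gr12 V -> exists2 v : 'cV[R]_2, v != 0 & V = <[v]>%VS.
Proof.
move=> V1; have V0 : vpick V != 0.
  by rewrite vpick0; apply/eqP => V0; move: V1; rewrite /Gr12/= V0 dimv0.
exists (vpick V) => //; apply/eqP.
by rewrite eq_sym eqEdim -memvE memv_pick V1 dim_vline V0.
Qed.

Lemma line_Gr12 (v : 'cV[R]_2) : v != 0 -> Gr12 <[v]>%VS.
Proof. by move=> v0; rewrite /Gr12/= dim_vline v0. Qed.

Lemma Gr12_nonempty : @Gr12 R !=set0.
Proof.
exists <[const_mx 1 : 'cV[R]_2]>%VS; apply: line_Gr12.
by apply/eqP => /matrixP/(_ 0 0)/eqP; rewrite !mxE oner_eq0.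
Qed.

End Lines.

(** * Uniform means determine the angular values *)

Section Averages.
Variables (R : realType) (A : 'M[R]_2).
Implicit Types (V : {vspace 'cV[R]_2}) (m : {vspace 'cV[R]_2} -> R).

Lemma angle_sumE k n V : angle_sum A k n V =
  \sum_(i < n) angle (mx_image (A ^+ (k + i)) V) (mx_image (A ^+ (k + i).+1) V).
Proof.
rewrite /angle_sum big_add1/= -{1}[k]add0n big_addn addKn big_mkord.
by apply: eq_bigr => i _; rewrite addnC.
Qed.

Lemma angle_sum_itv k n V : 0 <= angle_sum A k n V <= n%:R * (pi / 2).
Proof.
rewrite angle_sumE sumr_ge0; last by move=> i _; case/andP: (angle_itv R
  (mx_image (A ^+ (k + i)) V) (mx_image (A ^+ (k + i).+1) V)).
rewrite /= mulr_natl -[n in leRHS]card_ord -sumr_const ler_sum// => i _.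
by case/andP: (angle_itv R (mx_image (A ^+ (k + i)) V) (mx_image (A ^+ (k + i).+1) V)).
Qed.

Lemma angle_sumD k n p V :
  angle_sum A k (n + p) V = angle_sum A k n V + angle_sum A (k + n) p V.
Proof.
rewrite !angle_sumE big_split_ord/=; congr (_ + _).
by apply: eq_bigr => i _; rewrite addnA.
Qed.

(** [m V] is the mean angle along the orbit of [V], attained uniformly with
    respect to both the line and the starting time. *)
Definition uniform_mean m := forall e : R, 0 < e -> exists N, forall n k V,
  (N <= n)%N -> Gr12 V -> `|n%:R^-1 * angle_sum A k n V - m V| <= e.

Lemma uniform_mean_ubound m : uniform_mean m ->
  has_ubound [set m V | V in @Gr12 R].
Proof.
move=> /(_ 1 ltr01)[N HN]; exists (pi / 2 + 1) => _ [V GV <-].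
have := HN N.+1 0%N V (leqnSn _) GV; rewrite distrC => h.
rewrite -lerBlDl; apply: le_trans (le_trans (ler_norm _) h).
rewrite lerD2l lerN2 ler_pdivrMl ?ltr0n//.
by case/andP: (angle_sum_itv 0 N.+1 V).
Qed.

(** Under uniform convergence of the means, suprema and infima over lines and
    starting times commute with the limit up to a vanishing error. *)
Lemma angular_values_eq m : uniform_mean m ->
  [/\ [/\ uniform_outer_inf A = supV m, outer_inf A = supV m,
          outer_sup A = supV m & uniform_outer_sup A = supV m] &
      [/\ uniform_inner_inf A = supV m, inner_inf A = supV m,
          inner_sup A = supV m & uniform_inner_sup A = supV m]].
Proof.
move=> um; have mub := uniform_mean_ubound _ um.
have inner (f : nat -> {vspace 'cV[R]_2} -> R) :
    (forall e, 0 < e -> exists N, forall n V, (N <= n)%N -> Gr12 V ->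
       `|n%:R^-1 * f n V - m V| <= e) ->
    (fun n => n%:R^-1 * supV (f n)) @ \oo --> supV m.
  move=> H; apply: cvg_of_le => e e0; have [N HN] := H e e0.
  exists N.+1 => n Nn; apply: sup_close => //; first exact: Gr12_nonempty.
    by rewrite invr_gt0 ltr0n; case: n Nn.
  by move=> V GV; apply: HN => //; exact: ltnW.
have outer (f : nat -> {vspace 'cV[R]_2} -> R) V :
    (forall e, 0 < e -> exists N, forall n V, (N <= n)%N -> Gr12 V ->
       `|n%:R^-1 * f n V - m V| <= e) -> Gr12 V ->
    (fun n => n%:R^-1 * f n V) @ \oo --> m V.
  move=> H GV; apply: cvg_of_le => e e0; have [N HN] := H e e0.
  by exists N => n Nn; exact: HN.
have supV_eq (f : {vspace 'cV[R]_2} -> R) :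
    (forall V, Gr12 V -> f V = m V) -> supV f = supV m.
  by move=> fm; rewrite /supV; congr sup; apply: eq_imagel.
have c0 : forall e, 0 < e -> exists N, forall n V, (N <= n)%N -> Gr12 V ->
    `|n%:R^-1 * angle_sum A 0 n V - m V| <= e.
  by move=> e /um[N HN]; exists N => n V Nn GV; exact: HN.
have cs : forall e, 0 < e -> exists N, forall n V, (N <= n)%N -> Gr12 V ->
    `|n%:R^-1 * supk (fun k => angle_sum A k n V) - m V| <= e.
  move=> e /um[N HN]; exists N.+1 => n V Nn GV.
  apply: range_sup_close; first by rewrite invr_gt0 ltr0n; case: n Nn.
  by move=> k; apply: HN => //; exact: ltnW.
have ci : forall e, 0 < e -> exists N, forall n V, (N <= n)%N -> Gr12 V ->
    `|n%:R^-1 * infk (fun k => angle_sum A k n V) - m V| <= e.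
  move=> e /um[N HN]; exists N.+1 => n V Nn GV.
  apply: range_inf_close; first by rewrite invr_gt0 ltr0n; case: n Nn.
  by move=> k; apply: HN => //; exact: ltnW.
split; split.
- by apply: supV_eq => V GV; apply/cvg_lim => //; exact: (outer _ _ ci GV).
- by apply: supV_eq => V GV; rewrite (cvg_limn_inf_sup (outer _ _ c0 GV)).
- by apply: supV_eq => V GV; rewrite (cvg_limn_inf_sup (outer _ _ c0 GV)).
- by apply: supV_eq => V GV; apply/cvg_lim => //; exact: (outer _ _ cs GV).
- by rewrite /uniform_inner_inf (cvg_limn_inf_sup (inner _ ci)).
- by rewrite /inner_inf (cvg_limn_inf_sup (inner _ c0)).
- by rewrite /inner_sup (cvg_limn_inf_sup (inner _ c0)).
- by rewrite /uniform_inner_sup (cvg_limn_inf_sup (inner _ cs)).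
Qed.

(** If the means are asymptotically independent of the starting time, then they
    converge uniformly: the mean over [n * p] steps is close both to the mean
    over [n] steps and to the mean over [p] steps. *)
Lemma shift_uniform_mean :
  (forall e : R, 0 < e -> exists N, forall n k V, (N <= n)%N -> Gr12 V ->
     `|angle_sum A k n V - angle_sum A 0 n V| <= e * n%:R) ->
  exists m, uniform_mean m.
Proof.
move=> H.
pose x V n := n%:R^-1 * angle_sum A 0 n V.
have blocks e N : (forall n k V, (N <= n)%N -> Gr12 V ->
     `|angle_sum A k n V - angle_sum A 0 n V| <= e * n%:R) ->
   forall n p V, (N <= n)%N -> Gr12 V ->
     `|angle_sum A 0 (p * n) V - p%:R * angle_sum A 0 n V| <= p%:R * (e * n%:R).
  move=> HN n p V Nn GV; elim: p => [|p IH].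
    by rewrite mul0n !mul0r subr0 angle_sumE big_ord0 normr0.
  rewrite mulSnr angle_sumD add0n -natr1 !mulrDl !mul1r opprD addrACA.
  by apply: le_trans (ler_normD _ _) _; rewrite lerD// HN.
have cauchy e : 0 < e -> exists N, forall n p V, (N < n)%N -> (N < p)%N ->
    Gr12 V -> `|x V n - x V p| <= e.
  move=> e0; have [N HN] := H (e / 2) (divr_gt0 e0 (ltr0n _ 2)).
  exists N => n p V Nn Np GV.
  have h1 := blocks _ _ HN n p V (ltnW Nn) GV.
  have h2 := blocks _ _ HN p n V (ltnW Np) GV.
  have n0 : 0 < n%:R :> R by rewrite ltr0n; case: n Nn {h1 h2}.
  have p0 : 0 < p%:R :> R by rewrite ltr0n; case: p Np {h1 h2}.
  rewrite mulnC in h2.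
  have np0 : 0 < n%:R * p%:R :> R by rewrite mulr_gt0.
  rewrite -(ler_pM2l np0) -[X in X * `|_|](gtr0_norm np0) -normrM.
  have -> : n%:R * p%:R * (x V n - x V p) =
      (angle_sum A 0 (p * n) V - n%:R * angle_sum A 0 p V) -
      (angle_sum A 0 (p * n) V - p%:R * angle_sum A 0 n V).
    by rewrite /x; field; rewrite !gt_eqF.
  apply: le_trans (ler_normB _ _) _; apply: le_trans (lerD h2 h1) _.
  lra.
have xcvg V : Gr12 V -> cvgn (x V).
  move=> GV; apply/cauchy_cvgP/cauchy_exP => e e0.
  have [N HN] := cauchy (e / 2) (divr_gt0 e0 (ltr0n _ 2)).
  exists (x V N.+1); exists N.+1 => // p /= Np; rewrite /ball/=.
  by apply: le_lt_trans (HN _ _ _ (ltnSn N) Np GV) _; lra.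
exists (fun V => limn (x V)) => e e0.
have [N HN] := cauchy (e / 2) (divr_gt0 e0 (ltr0n _ 2)).
have [N' HN'] := H (e / 2) (divr_gt0 e0 (ltr0n _ 2)).
exists (maxn N N').+1 => n k V; rewrite gtn_max => /andP[Nn N'n] GV.
have n0 : 0 < n%:R :> R by rewrite ltr0n; case: n Nn N'n.
have h : `|x V n - limn (x V)| <= e / 2.
  rewrite ler_distl; apply/andP; split.
    rewrite lerBlDr; apply: limr_le; first exact: xcvg.
    exists N.+1 => // p /= Np; have := HN _ _ _ Nn Np GV.
    rewrite ler_distl; lra.
  rewrite -lerBlDr; apply: limr_ge; first exact: xcvg.
  exists N.+1 => // p /= Np; have := HN _ _ _ Nn Np GV.
  rewrite ler_distl; lra.
have -> : n%:R^-1 * angle_sum A k n V - limn (x V) =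
   n%:R^-1 * (angle_sum A k n V - angle_sum A 0 n V) + (x V n - limn (x V)).
  by rewrite /x mulrBr; ring.
apply: le_trans (ler_normD _ _) _.
rewrite [leRHS]splitr lerD// normrM gtr0_norm ?invr_gt0// ler_pdivrMl//.
by rewrite mulrC; apply: HN' => //; exact: ltnW.
Qed.

Lemma bounded_uniform_mean (C : R) :
  (forall k n V, Gr12 V -> angle_sum A k n V <= C) -> uniform_mean (fun=> 0).
Proof.
move=> H e e0; exists (Num.truncn (`|C| / e)).+1 => n k V Nn GV.
have n0 : 0 < n%:R :> R by rewrite ltr0n; case: n Nn.
rewrite subr0 normrM gtr0_norm ?invr_gt0// ler_pdivrMl//.
have /andP[a0 _] := angle_sum_itv k n V; rewrite ger0_norm//.
apply: le_trans (H _ _ _ GV) _; apply: le_trans (ler_norm _) _.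
rewrite -ler_pdivrMr//; apply: ltW.
apply: lt_le_trans (truncnS_gt _) _; by rewrite ler_nat.
Qed.

End Averages.

(** * Matrices with real eigenvalues: bounded angle sums *)

Section PlaneGeometry.
Variable R : realType.
Implicit Types (A B : 'M[R]_2) (v w : 'cV[R]_2).

(** The determinant of the two columns, that is the sine of the oriented angle
    times the two norms. *)
Definition cross v w : R := v 0 0 * w 1 0 - v 1 0 * w 0 0.

Lemma ord2_1 : lift ord0 ord0 = 1 :> 'I_2.
Proof. exact: val_inj. Qed.

Lemma mulmx2E A v i : (A *m v) i 0 = A i 0 * v 0 0 + A i 1 * v 1 0.
Proof. by rewrite mxE !big_ord_recl big_ord0 addr0 ord2_1. Qed.

Lemma dot2E v w : dot v w = v 0 0 * w 0 0 + v 1 0 * w 1 0.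
Proof. by rewrite /dot mxE !big_ord_recl big_ord0 addr0 ord2_1 !mxE. Qed.

Lemma colvec2P v w : v 0 0 = w 0 0 -> v 1 0 = w 1 0 -> v = w.
Proof.
move=> h0 h1; apply/matrixP => i j; rewrite ord1.
case: i => -[|[|//]] hi.
  by rewrite (_ : Ordinal hi = 0) ?h0//; exact: val_inj.
by rewrite (_ : Ordinal hi = 1) ?h1//; exact: val_inj.
Qed.

Lemma colvec2_eq0 v : (v == 0) = (v 0 0 == 0) && (v 1 0 == 0).
Proof.
apply/eqP/andP => [->|[/eqP h0 /eqP h1]]; first by rewrite !mxE.
by apply: colvec2P; rewrite mxE.
Qed.

Lemma dot_gt0 v : v != 0 -> 0 < dot v v.
Proof.
move=> v0; rewrite lt_def dot_ge0 andbT; apply: contraNneq v0.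
by rewrite dot2E -!expr2 colvec2_eq0 => /eqP; rewrite paddr_eq0 ?sqr_ge0// !sqrf_eq0.
Qed.

Lemma norm2_gt0 v : v != 0 -> 0 < norm2 v.
Proof. by move=> v0; rewrite sqrtr_gt0 dot_gt0. Qed.

Lemma norm2_sqr v : norm2 v ^+ 2 = dot v v.
Proof. by rewrite sqr_sqrtr ?dot_ge0. Qed.

Lemma dot_cross_sqr v w : dot v w ^+ 2 + cross v w ^+ 2 = dot v v * dot w w.
Proof. rewrite !dot2E /cross; ring. Qed.

Lemma cross_le v w : `|cross v w| <= norm2 v * norm2 w.
Proof.
rewrite -(ger0_norm (mulr_ge0 (sqrtr_ge0 (dot v v)) (sqrtr_ge0 (dot w w)))).
rewrite -ler_sqr ?nnegrE// !real_normK ?num_real// exprMn !norm2_sqr -dot_cross_sqr.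
by rewrite lerDr sqr_ge0.
Qed.

(** A crude form of Jordan's inequality. *)
Lemma le_4sin (x : R) : 0 <= x <= pi / 2 -> x <= 4 * sin x.
Proof.
move=> /andP[x0 xp]; have p2 := pihalf_lt2 R; have pg := pi_gt0 R.
have [s2|s2] := leP (2^-1) (sin x); first by lra.
have cx0 : 0 <= cos x by apply: cos_ge0_pihalf; apply/andP; split; lra.
have sx0 : 0 <= sin x by apply: sin_ge0_pi; apply/andP; split; lra.
have c2 : 2^-1 < cos x by have := cos2Dsin2 x; nra.
have [y yx] : exists2 y, y \in `[0, x] & sin x - sin 0 = cos y * (x - 0).
  apply: MVT_segment => //; apply: continuous_subspaceT => y; exact: continuous_sin.
rewrite sin0 !subr0 => ->.
move: yx; rewrite in_itv/= => /andP[y0 yx].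
have cxy : cos x <= cos y.
  rewrite leNgt ltr_cos ?in_itv/= -?leNgt//; apply/andP; split; lra.
nra.
Qed.

Lemma angle_le_cross v w : v != 0 -> w != 0 ->
  angle <[v]> <[w]> <= 4 * (`|cross v w| / (norm2 v * norm2 w)).
Proof.
move=> v0 w0; have := angle_itv R <[v]>%VS <[w]>%VS; rewrite angle_line//.
have /andP[c0 c1] := cos_line_itv R v w.
set c := _ / _ in c0 c1 * => /le_4sin; have cI : -1 <= c <= 1.
  by rewrite c1 (le_trans _ c0)// lerN10.
rewrite sin_acos//; suff -> : Num.sqrt (1 - c ^+ 2) = `|cross v w| / (norm2 v * norm2 w) by [].
have nv := norm2_gt0 v v0; have nw := norm2_gt0 w w0.
have -> : 1 - c ^+ 2 = (cross v w / (norm2 v * norm2 w)) ^+ 2.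
  rewrite /c !expr_div_n real_normK ?num_real// !exprMn !norm2_sqr.
  have := dot_cross_sqr v w; have := dot_gt0 v v0; have := dot_gt0 w w0.
  move=> ww vv e; have -> : cross v w ^+ 2 = dot v v * dot w w - dot v w ^+ 2.
    by rewrite -e addrC addKr.
  by field; rewrite !gt_eqF.
by rewrite sqrtr_sqr normrM normfV (gtr0_norm (mulr_gt0 nv nw)).
Qed.

Lemma dot_mulmx_le B : exists2 C, 0 < C & forall v, dot (B *m v) (B *m v) <= C * dot v v.
Proof.
exists (B 0 0 ^+ 2 + B 0 1 ^+ 2 + B 1 0 ^+ 2 + B 1 1 ^+ 2 + 1).
  by rewrite ltr_wpDl// !addr_ge0 ?sqr_ge0.
move=> v; rewrite !dot2E !mulmx2E -subr_ge0.
set a := B 0 0; set b := B 0 1; set c := B 1 0; set d := B 1 1.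
set x := v 0 0; set y := v 1 0.
set e := (X in 0 <= X).
have -> : e = (a * y - b * x) ^+ 2 + (c * y - d * x) ^+ 2 + x ^+ 2 + y ^+ 2.
  by rewrite /e; ring.
by rewrite !addr_ge0 ?sqr_ge0.
Qed.

Lemma mulmx_unit_neq0 A v : A \in unitmx -> v != 0 -> A *m v != 0.
Proof.
move=> uA; apply: contraNneq => /(congr1 (mulmx (invmx A))).
by rewrite mulKmx// mulmx0 => ->.
Qed.

Lemma exp_unit_neq0 A v k : A \in unitmx -> v != 0 -> A ^+ k *m v != 0.
Proof.
move=> uA v0; elim: k => [|k IH]; first by rewrite expr0 mul1mx.
by rewrite exprS -mulmxA mulmx_unit_neq0.
Qed.

(** The angle of one step is controlled by a quadratic form divided by the
    squared norm. *)
Lemma angle_step_le A : A \in unitmx -> exists2 C, 0 < C &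
  forall v, v != 0 -> angle <[v]> <[A *m v]> * dot v v <= C * `|cross v (A *m v)|.
Proof.
move=> uA; have [C C0 HC] := dot_mulmx_le (invmx A).
exists (4 * Num.sqrt C) => [|v v0]; first by rewrite mulr_gt0// sqrtr_gt0.
have w0 := mulmx_unit_neq0 A v uA v0.
have nv := norm2_gt0 v v0; have nw := norm2_gt0 _ w0.
have le : norm2 v <= Num.sqrt C * norm2 (A *m v).
  rewrite /norm2 -sqrtrM ?(ltW C0)// ler_wsqrtr//.
  by apply: le_trans (HC (A *m v)); rewrite mulKmx.
have h := angle_le_cross v _ v0 w0.
have {}h : angle <[v]> <[A *m v]> * (norm2 v * norm2 (A *m v)) <= 4 * `|cross v (A *m v)|.
  by rewrite -ler_pdivlMr ?mulr_gt0// -mulrA.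
have a0 : 0 <= angle <[v]> <[A *m v]> by case/andP: (angle_itv R <[v]>%VS <[A *m v]>%VS).
rewrite -norm2_sqr expr2.
have sC : 0 <= Num.sqrt C by exact: sqrtr_ge0.
apply: (@le_trans _ _ (angle <[v]> <[A *m v]> * (norm2 v * norm2 (A *m v)) * Num.sqrt C)).
  by rewrite -!mulrA ler_wpM2l// ler_wpM2l ?(ltW nv)// mulrC.
by rewrite [leRHS]mulrAC ler_wpM2r.
Qed.

Lemma angle_sum_line A v k n : angle_sum A k n <[v]> =
  \sum_(i < n) angle <[A ^+ (k + i) *m v]> <[A *m (A ^+ (k + i) *m v)]>.
Proof.
rewrite angle_sumE; apply: eq_bigr => i _.
by rewrite !mx_image_line exprS mulmxA.
Qed.

(** Angles dominated by the increments of a bounded function along the orbits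
    have bounded sums. *)
Lemma potential_bounded A (G : 'cV[R]_2 -> R) (M : R) : A \in unitmx ->
  (forall v, v != 0 -> angle <[v]> <[A *m v]> <= G (A *m v) - G v) ->
  (forall v, v != 0 -> `|G v| <= M) ->
  forall k n V, Gr12 V -> angle_sum A k n V <= M + M.
Proof.
move=> uA HG HM k n V /Gr12_line[v v0 ->].
have e0 i := exp_unit_neq0 A v i uA v0.
rewrite angle_sum_line.
apply: (@le_trans _ _ (\sum_(i < n) (G (A ^+ (k + i).+1 *m v) - G (A ^+ (k + i) *m v)))).
  by apply: ler_sum => i _; rewrite exprS -mulmxA; apply: HG.
have -> : \sum_(i < n) (G (A ^+ (k + i).+1 *m v) - G (A ^+ (k + i) *m v)) =
    G (A ^+ (k + n) *m v) - G (A ^+ k *m v).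
  elim: n => [|n IH]; first by rewrite big_ord0 addn0 subrr.
  by rewrite big_ord_recr/= IH addnS addrC addrA subrK.
apply: le_trans (ler_norm _) _; apply: le_trans (ler_normB _ _) _.
by rewrite lerD ?HM.
Qed.

(** With [p] and [q] proportional to the moduli of the components of [v] along
    the eigenvectors for [l1] and [l2], the angle of a step is at most a multiple of
    [p q / (p + q) ^ 2], and so is dominated by the decrease of
    [q / (p + q)]. *)
Lemma hyperbolic_bounded A l1 l2 : A \in unitmx ->
  A 0 0 + A 1 1 = l1 + l2 -> A 0 0 * A 1 1 - A 0 1 * A 1 0 = l1 * l2 ->
  `|l2| < `|l1| ->
  exists C, forall k n V, Gr12 V -> angle_sum A k n V <= C.
Proof.
move=> uA tA dA l12.
have l10 : 0 < `|l1| by exact: le_lt_trans l12.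
have dl : l1 - l2 != 0 by apply: contraTneq l12 => /subr0_eq ->; rewrite ltxx.
have [C C0 HC] := angle_step_le A uA.
(* X v and Y v are multiples of the components of v for l1 and l2. *)
pose X := A - l2%:M; pose Y := A - l1%:M.
have [C1 C10 HX] := dot_mulmx_le X; have [C2 C20 HY] := dot_mulmx_le Y.
pose p v := norm2 (X *m v); pose q v := norm2 (Y *m v).
have coord (l : R) v i : ((A - l%:M) *m v) i 0 = A i 0 * v 0 0 + A i 1 * v 1 0 - l * v i 0.
  by rewrite mulmxBl mul_scalar_mx mxE mulmx2E !mxE.
(* Cayley-Hamilton: the two images are eigenvectors *)
have AX v : X *m (A *m v) = l1 *: (X *m v).
  have e : A 1 1 = l1 + l2 - A 0 0 by rewrite -tA addrAC subrr add0r.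
  rewrite e in dA; have {}dA : A 0 1 * A 1 0 = A 0 0 * (l1 + l2 - A 0 0) - l1 * l2.
    by rewrite -dA opprB addrC subrK.
  apply: colvec2P; rewrite [in RHS]mxE !coord !mulmx2E e; ring: dA.
have AY v : Y *m (A *m v) = l2 *: (Y *m v).
  have e : A 1 1 = l1 + l2 - A 0 0 by rewrite -tA addrAC subrr add0r.
  rewrite e in dA; have {}dA : A 0 1 * A 1 0 = A 0 0 * (l1 + l2 - A 0 0) - l1 * l2.
    by rewrite -dA opprB addrC subrK.
  apply: colvec2P; rewrite [in RHS]mxE !coord !mulmx2E e; ring: dA.
have pA v : p (A *m v) = `|l1| * p v by rewrite /p AX norm2Z.
have qA v : q (A *m v) = `|l2| * q v by rewrite /q AY norm2Z.
have p0 v : 0 <= p v by exact: sqrtr_ge0.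
have q0 v : 0 <= q v by exact: sqrtr_ge0.
have pq0 v : v != 0 -> 0 < p v + q v.
  move=> v0; rewrite lt_def addr_ge0// andbT paddr_eq0//.
  apply: contra_neqN v0 => /andP[/eqP pv /eqP qv].
  have xv : X *m v = 0.
    by apply/eqP; apply: contraPT pv => /norm2_gt0; rewrite /p => /gt_eqF/eqP.
  have yv : Y *m v = 0.
    by apply/eqP; apply: contraPT qv => /norm2_gt0; rewrite /q => /gt_eqF/eqP.
  have : (l1 - l2) *: v = 0.
    rewrite -[RHS](subrr 0) -{1}xv -yv /X /Y !mulmxBl !mul_scalar_mx scalerBl.
    by rewrite opprB [RHS]addrC addrA subrK.
  by move/eqP; rewrite scaler_eq0 (negbTE dl)/= => /eqP.
have crossE v : (l1 - l2) * cross v (A *m v) = cross (X *m v) (Y *m v).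
  by rewrite /cross !coord !mulmx2E; ring.
have pC v : p v ^+ 2 <= C1 * dot v v by rewrite /p norm2_sqr.
have qC v : q v ^+ 2 <= C2 * dot v v by rewrite /q norm2_sqr.
pose E := C * (C1 + C2) * 2 / `|l1 - l2| * (`|l1| / (`|l1| - `|l2|)).
have E0 : 0 <= E.
  rewrite /E !mulr_ge0 ?invr_ge0 ?(ltW C0)//; last by rewrite subr_ge0 ltW.
  by rewrite addr_ge0 ?(ltW C10) ?(ltW C20).
exists (E + E); apply: (potential_bounded _ (fun v => - E * (q v / (p v + q v)))) => // v v0.
- have pq := pq0 v v0; have pqA := pq0 _ (mulmx_unit_neq0 _ _ uA v0).
  have vv := dot_gt0 v v0.
  have step : angle <[v]> <[A *m v]> * (p v + q v) ^+ 2 <=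
      C * (C1 + C2) * 2 / `|l1 - l2| * (p v * q v).
    have a0 : 0 <= angle <[v]> <[A *m v]> by case/andP: (angle_itv R <[v]>%VS <[A *m v]>%VS).
    have h1 : (p v + q v) ^+ 2 <= 2 * (C1 + C2) * dot v v.
      have := pC v; have := qC v; have := sqr_ge0 (p v - q v); nra.
    apply: (le_trans (ler_wpM2l a0 h1)).
    have := HC v v0; have := cross_le (X *m v) (Y *m v).
    rewrite -crossE normrM -/(p v) -/(q v) => h2 h3.
    have dl0 : 0 < `|l1 - l2| by rewrite normr_gt0.
    have -> : angle <[v]> <[A *m v]> * (2 * (C1 + C2) * dot v v) =
      2 * (C1 + C2) * (angle <[v]> <[A *m v]> * dot v v) by ring.
    apply: (@le_trans _ _ (2 * (C1 + C2) * (C * `|cross v (A *m v)|))).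
      by rewrite ler_wpM2l// mulr_ge0// addr_ge0 ?ltW.
    have -> : 2 * (C1 + C2) * (C * `|cross v (A *m v)|) =
      C * (C1 + C2) * 2 / `|l1 - l2| * (`|l1 - l2| * `|cross v (A *m v)|).
      by field; rewrite gt_eqF.
    by rewrite ler_wpM2l// !mulr_ge0 ?invr_ge0 ?addr_ge0 ?ltW.
  rewrite pA qA in pqA *.
  move: step; rewrite -ler_pdivlMr ?exprn_gt0// => /le_trans; apply.
  have dl1 : 0 < `|l1| - `|l2| by rewrite subr_gt0.
  have EE x y : - E * x - - E * y = E * (y - x) by ring.
  rewrite EE /E -[leRHS]mulrA -[leLHS]mulrA.
  have K0 : 0 <= C * (C1 + C2) * 2 / `|l1 - l2|.
    by rewrite !mulr_ge0 ?invr_ge0 ?addr_ge0 ?(ltW C0) ?(ltW C10) ?(ltW C20).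
  rewrite ler_wpM2l//.
  have -> : `|l1| / (`|l1| - `|l2|) * (q v / (p v + q v) - `|l2| * q v / (`|l1| * p v + `|l2| * q v)) =
     p v * q v * (`|l1| / ((p v + q v) * (`|l1| * p v + `|l2| * q v))).
    by field; rewrite !gt_eqF.
  rewrite ler_wpM2l ?mulr_ge0// ler_pdivlMr ?mulr_gt0// mulrC ler_pdivrMr ?exprn_gt0//.
  by rewrite expr2 mulrCA ler_pM2l// mulrDr lerD2l ler_wpM2r// ltW.
- rewrite mulNr normrN normrM (ger0_norm E0) -[leRHS]mulr1 ler_wpM2l//.
  have pq := pq0 v v0.
  by rewrite ger0_norm ?divr_ge0 ?(ltW pq)// ler_pdivrMr// mul1r lerDr.
Qed.

Lemma det_mx2 (F : comNzRingType) (B : 'M[F]_2) :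
  \det B = B 0 0 * B 1 1 - B 0 1 * B 1 0.
Proof.
rewrite (expand_det_row _ 0) !big_ord_recl big_ord0 addr0 /cofactor !det_mx11 !mxE.
rewrite /= expr0 mul1r expr1 mulN1r mulrN.
congr (_ * B _ _ - _ * B _ _); try exact: val_inj.
by congr (B _ _); exact: val_inj.
Qed.

(** An increasing bounded function whose increments over steps of fixed length
    decay like [1 / t ^ 2]. *)
Definition squash (t : R) : R := t / (1 + `|t|).

Lemma squash_le1 t : `|squash t| <= 1.
Proof.
have h : 0 < 1 + `|t| by rewrite ltr_pwDl.
by rewrite normrM normfV (gtr0_norm h) ler_pdivrMr// mul1r lerDr.
Qed.

Lemma squash_incr s t : 0 < s ->
  s / (2 * (1 + s)) / (1 + t ^+ 2) <= squash (t + s) - squash t.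
Proof.
move=> s0; have t2 := sqr_ge0 t.
have st : 0 < 2 * (1 + s) * (1 + t ^+ 2) by nra.
rewrite -mulrA -invfM /squash.
have [t0|t0] := leP 0 t.
  rewrite !ger0_norm//; last by lra.
  have -> : (t + s) / (1 + (t + s)) - t / (1 + t) = s / ((1 + (t + s)) * (1 + t)).
    by field; rewrite !gt_eqF//; lra.
  rewrite ler_pM2l// lef_pV2 ?posrE//; last by nra.
  have h1 : 0 <= t * s * (1 + t) by rewrite mulr_ge0 ?(mulr_ge0 t0 (ltW s0))//; lra.
  have h2 : 0 <= (1 + s) * (1 - t) ^+ 2 by rewrite mulr_ge0 ?sqr_ge0 ?addr_ge0 ?ltW.
  nra.
have [ts|ts] := leP (t + s) 0.
  rewrite !ler0_norm//; last by lra.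
  have -> : (t + s) / (1 - (t + s)) - t / (1 - t) = s / ((1 - (t + s)) * (1 - t)).
    by field; rewrite !gt_eqF//; lra.
  rewrite ler_pM2l// lef_pV2 ?posrE//; last by nra.
  have h1 : 0 <= s * (1 - t) by rewrite mulr_ge0 ?ltW//; lra.
  have h2 : 0 <= s * (1 + t ^+ 2) by rewrite mulr_ge0 ?ltW//; lra.
  have := sqr_ge0 (1 + t); nra.
rewrite gtr0_norm// ltr0_norm//.
apply: (@le_trans _ _ (s / (1 + s))).
  rewrite ler_pM2l// lef_pV2 ?posrE//; last by lra.
  nra.
have -> : s / (1 + s) = (t + s) / (1 + s) + (- t) / (1 + s) by field; rewrite gt_eqF//; lra.
rewrite -mulNr lerD//.
  by rewrite ler_pM2l// lef_pV2 ?posrE//; lra.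
by rewrite ler_pM2l ?lef_pV2 ?posrE//; lra.
Qed.

(** Let [N = A - l].  If [N v] is not zero, the ratio [t] of the component of [v]
    along [N v] to [N v] increases by [l^-1] at each step, and the angle is at
    most a multiple of [1 / (1 + t ^ 2)].  If it is zero, the line is fixed. *)
Lemma parabolic_bounded A l : A \in unitmx ->
  A 0 0 + A 1 1 = l + l -> A 0 0 * A 1 1 - A 0 1 * A 1 0 = l * l ->
  exists C, forall k n V, Gr12 V -> angle_sum A k n V <= C.
Proof.
move=> uA tA dA.
have l0 : l != 0.
  apply: contraTneq uA => l0; rewrite unitmxE det_mx2 dA l0 mul0r.
  by rewrite unitr0.
have [C C0 HC] := angle_step_le A uA.
have e : A 1 1 = l + l - A 0 0 by rewrite -tA addrAC subrr add0r.
rewrite e in dA; have {}dA : A 0 1 * A 1 0 = A 0 0 * (l + l - A 0 0) - l * l.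
  by rewrite -dA opprB addrC subrK.
have [bc|bc] := eqVneq (A 1 0) (A 0 1).
  (* a symmetric matrix with a double eigenvalue is scalar *)
  have b0 : A 0 1 = 0.
    apply/eqP; rewrite -sqrf_eq0; apply/eqP; have := sqr_ge0 (A 0 0 - l).
    have := sqr_ge0 (A 0 1); rewrite bc in dA; nra.
  have a0 : A 0 0 = l.
    apply/eqP; rewrite -subr_eq0 -sqrf_eq0; apply/eqP.
    by rewrite b0 mul0r in dA; nra.
  exists (0 + 0); apply: (potential_bounded _ (fun=> 0)) => // v v0; last by rewrite normr0.
  have := HC v v0; rewrite /cross !mulmx2E e bc b0 a0.
  have -> : v 0 0 * (0 * v 0 0 + (l + l - l) * v 1 0) - v 1 0 * (l * v 0 0 + 0 * v 1 0) = 0 by ring.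
  by rewrite normr0 mulr0 subr0 pmulr_lle0// dot_gt0.
pose N := A - l%:M; have [C1 C10 HN] := dot_mulmx_le N.
have coord v i : (N *m v) i 0 = A i 0 * v 0 0 + A i 1 * v 1 0 - l * v i 0.
  by rewrite mulmxBl mul_scalar_mx mxE mulmx2E !mxE.
have AN v : N *m (A *m v) = l *: (N *m v).
  apply: colvec2P; rewrite [in RHS]mxE !coord !mulmx2E e; ring: dA.
have AE v : A *m v = l *: v + N *m v by rewrite mulmxBl mul_scalar_mx addrC subrK.
pose d := A 1 0 - A 0 1; have d0 : d != 0 by rewrite subr_eq0.
(* since N is nilpotent, both sides are multiples of the square of the linear form
   that vanishes on the kernel of N *)
have crossE v : d * cross v (A *m v) = dot (N *m v) (N *m v).
  rewrite dot2E /cross !coord !mulmx2E e /d; ring: dA.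
pose t v := dot v (N *m v) / dot (N *m v) (N *m v).
have tA' v : N *m v != 0 -> t (A *m v) = t v + l^-1.
  move=> /dot_gt0 yy; rewrite /t AN dotZ.
  have -> : dot (A *m v) (l *: (N *m v)) = l * (l * dot v (N *m v) + dot (N *m v) (N *m v)).
    by rewrite AE !dot2E !mxE; ring.
  by field; rewrite l0 gt_eqF.
have yv v : dot (N *m v) (N *m v) * (1 + t v ^+ 2) <= (1 + C1) * dot v v.
  have [y0|y0] := eqVneq (N *m v) 0.
    rewrite y0 [dot 0 0]dot2E !mxE !mul0r addr0 mul0r mulr_ge0 ?dot_ge0//.
    by rewrite addr_ge0// ltW.
  have yy := dot_gt0 _ y0.
  rewrite mulrDr mulr1 [leRHS]mulrDl mul1r addrC lerD// /t.
  have -> : dot (N *m v) (N *m v) * (dot v (N *m v) / dot (N *m v) (N *m v)) ^+ 2 =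
      dot v (N *m v) ^+ 2 / dot (N *m v) (N *m v) by field; rewrite gt_eqF.
  by rewrite ler_pdivrMr// dot_sqr_le.
pose s := `|l^-1|; have s0 : 0 < s by rewrite normr_gt0 invr_eq0.
pose E := C / `|d| * (1 + C1) * (2 * (1 + s) / s).
have E0 : 0 <= E.
  by rewrite /E !mulr_ge0 ?invr_ge0 ?addr_ge0// ltW.
exists (E + E).
apply: (potential_bounded _ (fun v => E * squash (Num.sg (l^-1) * t v))) => // v v0; last first.
  by rewrite normrM (ger0_norm E0) ler_piMr// squash_le1.
have vv := dot_gt0 v v0; have := HC v v0.
have d0' : 0 < `|d| by rewrite normr_gt0.
have -> : `|cross v (A *m v)| = dot (N *m v) (N *m v) / `|d|.
  rewrite -crossE -[X in X / _]ger0_norm; last by rewrite crossE dot_ge0.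
  by rewrite normrM mulrC mulKf// gt_eqF.
have [y0|y0] := eqVneq (N *m v) 0.
  have dz w : dot 0 w = 0 by rewrite dot2E !mxE !mul0r addr0.
  rewrite {1}y0 dz mul0r mulr0.
  rewrite pmulr_lle0// => /le_trans; apply; rewrite /t AN y0 scaler0.
  by rewrite ![dot _ 0]dot2E !mxE !mulr0 addr0 !mul0r !mulr0 subrr.
move=> step; rewrite tA'// mulrDr -mulrBr -normrEsg.
have h := squash_incr _ (Num.sg l^-1 * t v) s0.
have sg2 : (Num.sg l^-1 * t v) ^+ 2 = t v ^+ 2.
  by rewrite exprMn sqr_sg invr_eq0 l0 mul1r.
rewrite sg2 in h; rewrite -/s.
apply: le_trans (ler_wpM2l E0 h).
have t1 : 0 < 1 + t v ^+ 2 by rewrite ltr_pwDl ?sqr_ge0.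
have s1 : 0 < 1 + s by rewrite addr_gt0.
have -> : E * (s / (2 * (1 + s)) / (1 + t v ^+ 2)) = C / `|d| * (1 + C1) / (1 + t v ^+ 2).
  by rewrite /E; field; rewrite !gt_eqF.
rewrite ler_pdivlMr// -(ler_pM2r vv) mulrAC.
apply: (@le_trans _ _ (C * (dot (N *m v) (N *m v) / `|d|) * (1 + t v ^+ 2))).
  by rewrite ler_pM2r.
have -> : C * (dot (N *m v) (N *m v) / `|d|) * (1 + t v ^+ 2) =
   C / `|d| * (dot (N *m v) (N *m v) * (1 + t v ^+ 2)) by ring.
by rewrite -[leRHS]mulrA ler_wpM2l// mulr_ge0 ?invr_ge0 ?ltW.
Qed.

End PlaneGeometry.

(** * Lipschitz estimates *)

Section BoundedLipschitz.
Variable R : realType.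
Implicit Types f g : R -> R.

(** Functions bounded by [B] and Lipschitz with constant [B], for some [B]; they
    form an algebra. *)
Definition bounded_lipschitz f := exists B,
  (forall x, `|f x| <= B) /\ (forall x y, `|f x - f y| <= B * `|x - y|).

Lemma derive1_le1_dist f (df : R -> R) :
  (forall x : R, is_derive x 1 f (df x)) -> (forall x, `|df x| <= 1) ->
  forall x y, `|f x - f y| <= `|x - y|.
Proof.
move=> fd df1.
have fc : continuous f.
  by move=> x; apply/differentiable_continuous/derivable1_diffP; case: (fd x).
have main x y : x <= y -> `|f y - f x| <= `|y - x|.
  move=> xy; have [c _ ->] : exists2 c, c \in `[x, y] & f y - f x = df c * (y - x).
    by apply: MVT_segment => //; exact: continuous_subspaceT.
  by rewrite normrM ler_piMl.
move=> x y; have [xy|/ltW yx] := leP x y; last exact: main.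
by rewrite distrC (distrC x); exact: main.
Qed.

Lemma bounded_lipschitz_cos : bounded_lipschitz (@cos R).
Proof.
exists 1; split=> [x|x y]; first exact: cos_max.
rewrite mul1r; apply: (@derive1_le1_dist _ (fun x => - sin x)) => z.
by rewrite normrN sin_max.
Qed.

Lemma bounded_lipschitz_sin : bounded_lipschitz (@sin R).
Proof.
exists 1; split=> [x|x y]; first exact: sin_max.
rewrite mul1r; apply: (@derive1_le1_dist _ (@cos R)) => z; exact: cos_max.
Qed.

Lemma bounded_lipschitz_cst c : bounded_lipschitz (fun=> c).
Proof. by exists `|c|; split=> // x y; rewrite subrr normr0 mulr_ge0. Qed.

Lemma bounded_lipschitzD f g : bounded_lipschitz f -> bounded_lipschitz g ->
  bounded_lipschitz (fun x => f x + g x).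
Proof.
move=> [B [fB fL]] [C [gB gL]]; exists (B + C); split=> [x|x y].
  by rewrite (le_trans (ler_normD _ _))// lerD.
by rewrite opprD addrACA mulrDl (le_trans (ler_normD _ _))// lerD.
Qed.

Lemma bounded_lipschitzM f g : bounded_lipschitz f -> bounded_lipschitz g ->
  bounded_lipschitz (fun x => f x * g x).
Proof.
move=> [B [fB fL]] [C [gB gL]]; exists (B * C + B * C).
have B0 : 0 <= B by exact: le_trans (fB 0).
have C0 : 0 <= C by exact: le_trans (gB 0).
split=> [x|x y].
  by rewrite normrM ler_wpDr ?mulr_ge0// ler_pM.
have -> : f x * g x - f y * g y = f x * (g x - g y) + g y * (f x - f y) by ring.
rewrite mulrDl (le_trans (ler_normD _ _))// !normrM lerD//.
  by rewrite -mulrA ler_pM.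
by rewrite [B * C]mulrC -mulrA ler_pM.
Qed.

Lemma bounded_lipschitzV f (d : R) : 0 < d -> (forall x, d <= f x) ->
  bounded_lipschitz f -> bounded_lipschitz (fun x => (f x)^-1).
Proof.
move=> d0 fd [B [fB fL]].
have f0 x : 0 < f x by exact: lt_le_trans (fd x).
have fV x : (f x)^-1 <= d^-1 by rewrite lef_pV2 ?posrE.
have B0 : 0 <= B by exact: le_trans (fB 0).
exists (d^-1 + B / d / d); split=> [x|x y].
  rewrite gtr0_norm ?invr_gt0// ler_wpDr//.
  by rewrite !mulr_ge0 ?invr_ge0// ltW.
have -> : (f x)^-1 - (f y)^-1 = (f y - f x) * ((f x)^-1 * (f y)^-1).
  by field; rewrite !gt_eqF.
rewrite normrM (distrC (f y)) mulrDl ler_wpDl ?mulr_ge0 ?invr_ge0 ?(ltW d0)//.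
have -> : B / d / d * `|x - y| = B * `|x - y| * (d^-1 * d^-1) by ring.
rewrite ler_pM//.
have f0' z : 0 <= (f z)^-1 by rewrite invr_ge0 ltW.
by rewrite ger0_norm ?mulr_ge0// ler_pM.
Qed.

Lemma lipschitz_atan_comp f : bounded_lipschitz f ->
  exists2 B, 0 <= B & forall x y, `|atan (f x) - atan (f y)| <= B * `|x - y|.
Proof.
move=> [B [fB fL]]; exists B => [|x y]; first exact: le_trans (fB 0).
apply: le_trans (fL x y).
apply: (@derive1_le1_dist _ (fun x => (1 + x ^+ 2)^-1)) => z.
have z1 : 1 <= 1 + z ^+ 2 by rewrite lerDl sqr_ge0.
by rewrite ger0_norm ?invr_ge0 ?(le_trans ler01)// invf_le1// (lt_le_trans ltr01).
Qed.

End BoundedLipschitz.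

(** * Rotations seen through a positive definite matrix *)

Section Ellipse.
Variables (R : realType) (a b p : R).
Hypotheses (a0 : 0 < a) (pab : p ^+ 2 < a * b).

(** The image of [(cos t, sin t)] under the positive definite matrix
    [[a, p], [p, b]]; it describes an ellipse. *)
Definition ell (t : R) : 'cV[R]_2 :=
  \col_i (if i == 0 then a * cos t + p * sin t else p * cos t + b * sin t).

Lemma ell0 t : ell t 0 0 = a * cos t + p * sin t.
Proof. by rewrite mxE. Qed.

Lemma ell1 t : ell t 1 0 = p * cos t + b * sin t.
Proof. by rewrite mxE. Qed.

(** Scalar and cross products of [(cos t, sin t)] with [ell t]. *)
Definition ell_dot t := cos t * (a * cos t + p * sin t) + sin t * (p * cos t + b * sin t).
Definition ell_cross t := cos t * (p * cos t + b * sin t) + - sin t * (a * cos t + p * sin t).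

Let b0 : 0 < b.
Proof.
have : 0 < a * b by exact: le_lt_trans (sqr_ge0 p) pab.
by rewrite pmulr_rgt0.
Qed.

Let d0 : 0 < (a * b - p ^+ 2) / (a + b).
Proof. by rewrite divr_gt0 ?subr_gt0// addr_gt0. Qed.

Lemma ell_dot_ge t : (a * b - p ^+ 2) / (a + b) <= ell_dot t.
Proof.
have ab0 : 0 < a + b by rewrite addr_gt0.
(* Cayley-Hamilton for P: tr P * <e, P e> - det P = |P e|^2 for unit e *)
rewrite ler_pdivrMr// -subr_ge0 -[X in _ - X]mulr1 -(cos2Dsin2 t) /ell_dot.
set c := cos t; set s := sin t; set e := (X in 0 <= X).
have -> : e = (a * c + p * s) ^+ 2 + (p * c + b * s) ^+ 2 by rewrite /e; ring.
by rewrite addr_ge0 ?sqr_ge0.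
Qed.

Lemma ell_dot_gt0 t : 0 < ell_dot t.
Proof. exact: lt_le_trans (ell_dot_ge t). Qed.

(** The angle from the unit vector at angle [t] to its image under the
    positive definite matrix; it is bounded and periodic. *)
Definition tilt t : R := atan (ell_cross t / ell_dot t).

Lemma tilt_itv t : - (pi / 2) < tilt t < pi / 2.
Proof. by rewrite atan_gtNpi2 atan_ltpi2. Qed.

Lemma tiltDpi t n : tilt (t + pi *+ n) = tilt t.
Proof.
apply: (@periodicn _ _ tilt pi) => {}t.
by rewrite /tilt /ell_cross /ell_dot sinDpi cosDpi; congr (atan (_ / _)); ring.
Qed.

Lemma tilt_lipschitz : exists2 B, 0 <= B &
  forall x y, `|tilt x - tilt y| <= B * `|x - y|.
Proof.
apply: lipschitz_atan_comp.
have C := bounded_lipschitz_cos R; have S := bounded_lipschitz_sin R.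
have X : bounded_lipschitz R (fun t => a * cos t + p * sin t).
  by apply: bounded_lipschitzD; apply: bounded_lipschitzM => //; exact: bounded_lipschitz_cst.
have Y : bounded_lipschitz R (fun t => p * cos t + b * sin t).
  by apply: bounded_lipschitzD; apply: bounded_lipschitzM => //; exact: bounded_lipschitz_cst.
have N : bounded_lipschitz R (fun t : R => - sin t).
  have -> : (fun t : R => - sin t) = (fun t => -1 * sin t).
    by apply/funext => t; rewrite mulN1r.
  by apply: bounded_lipschitzM => //; exact: bounded_lipschitz_cst.
apply: bounded_lipschitzM.
  by apply: bounded_lipschitzD; exact: bounded_lipschitzM.
apply: (bounded_lipschitzV _ _ _ d0 ell_dot_ge).
by apply: bounded_lipschitzD; exact: bounded_lipschitzM.
Qed.

Lemma ell_polar t : exists2 r, 0 < r &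
  a * cos t + p * sin t = r * cos (t + tilt t) /\
  p * cos t + b * sin t = r * sin (t + tilt t).
Proof.
set u := ell_cross t / ell_dot t.
have u1 : 0 < Num.sqrt (1 + u ^+ 2) by rewrite sqrtr_gt0 ltr_pwDl ?sqr_ge0.
have dt := ell_dot_gt0 t.
exists (ell_dot t * Num.sqrt (1 + u ^+ 2)); first by rewrite mulr_gt0.
have ct : cos (tilt t) = (Num.sqrt (1 + u ^+ 2))^-1 by rewrite cos_atan.
have st : sin (tilt t) = u * (Num.sqrt (1 + u ^+ 2))^-1.
  rewrite -ct -[u](@atanK R) -/(tilt t) /tan divfK//.
  by rewrite ct invr_eq0 gt_eqF.
have uE : ell_dot t * u = ell_cross t by rewrite mulrCA divff ?mulr1// gt_eqF.
rewrite sinD cosD ct st.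
have e1 := cos2Dsin2 t.
split.
  transitivity (ell_dot t * cos t - ell_dot t * u * sin t); last by field; rewrite gt_eqF.
  rewrite uE /ell_dot /ell_cross.
  by rewrite -[LHS]mulr1 -e1; ring.
transitivity (ell_dot t * sin t + ell_dot t * u * cos t); last by field; rewrite gt_eqF.
rewrite uE /ell_dot /ell_cross.
by rewrite -[LHS]mulr1 -e1; ring.
Qed.

Lemma ell_neq0 t : ell t != 0.
Proof.
apply/eqP => /matrixP h; have := ell_dot_gt0 t.
by rewrite /ell_dot -ell0 -ell1 !h !mxE !mulr0 addr0 ltxx.
Qed.

Lemma ell_onto (v : 'cV[R]_2) : v != 0 -> exists s t, s != 0 /\ v = s *: ell t.
Proof.
move=> v0; have D0 : a * b - p ^+ 2 != 0 by rewrite gt_eqF// subr_gt0.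
pose z := Complex ((b * v 0 0 - p * v 1 0) / (a * b - p ^+ 2)) ((a * v 1 0 - p * v 0 0) / (a * b - p ^+ 2)).
have zx : a * complex.Re z + p * complex.Im z = v 0 0 by rewrite /z/=; field.
have zy : p * complex.Re z + b * complex.Im z = v 1 0 by rewrite /z/=; field.
have z0 : z != 0.
  apply: contraNneq v0 => z0; rewrite colvec2_eq0 -zx -zy z0/=.
  by rewrite !mulr0 addr0 eqxx.
have [_ hx hy] := cargP z0; exists (cabs z), (carg z); split.
  apply: contraNneq v0 => c0; rewrite colvec2_eq0 -zx -zy hx hy c0.
  by rewrite !mul0r !mulr0 addr0 eqxx.
apply: colvec2P; rewrite [RHS]mxE ?ell0 ?ell1 -?zx -?zy hx hy; ring.
Qed.

Variable phi : R.
Hypothesis phi_itv : 0 < phi < pi.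

(** The oriented angle from [ell t] to [ell (t + phi)]. *)
Definition turn t : R := phi + tilt (t + phi) - tilt t.

(** The bound on [tilt] places [turn t] in [(- pi, 2 pi)], and its sine has the
    sign of the determinant of [ell t] and [ell (t + phi)], which is
    positive. *)
Lemma turn_itv t : 0 < turn t < pi.
Proof.
have [r r0 [hx hy]] := ell_polar t; have [r' r'0 [hx' hy']] := ell_polar (t + phi).
have /andP[f0 fp] := phi_itv.
have s0 : 0 < sin (turn t).
  have : 0 < (a * b - p ^+ 2) * sin phi by rewrite mulr_gt0 ?subr_gt0// sin_gt0_pi.
  have -> : (a * b - p ^+ 2) * sin phi = r * r' * sin (turn t).
    have -> : turn t = (t + phi + tilt (t + phi)) - (t + tilt t) by rewrite /turn; ring.
    rewrite [in RHS]sinB.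
    transitivity ((r * cos (t + tilt t)) * (r' * sin (t + phi + tilt (t + phi))) -
      (r * sin (t + tilt t)) * (r' * cos (t + phi + tilt (t + phi)))); last by ring.
    rewrite -hx -hy -hx' -hy' sinD cosD -[sin phi in LHS]mul1r -(cos2Dsin2 t).
    ring.
  by rewrite pmulr_rgt0// mulr_gt0.
have /andP[h1 h2] := tilt_itv t; have /andP[h3 h4] := tilt_itv (t + phi).
apply/andP; split; rewrite ltNge; apply/negP => h.
  have : 0 <= sin (- turn t).
    by apply: sin_ge0_pi; apply/andP; split; rewrite /turn in h *; lra.
  by rewrite sinN oppr_ge0 leNgt s0.
have : 0 <= sin (turn t - pi).
  by apply: sin_ge0_pi; apply/andP; split; rewrite /turn in h *; lra.
by rewrite sinB sinpi cospi mulr0 subr0 mulrN1 oppr_ge0 leNgt s0.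
Qed.

(** The angle between the lines through [ell t] and [ell (t + phi)]: the
    smaller of [turn t] and [pi - turn t]. *)
Definition step t : R := pi / 2 - `|pi / 2 - turn t|.

Lemma norm2_polar (v : 'cV[R]_2) r t : 0 < r -> v 0 0 = r * cos t ->
  v 1 0 = r * sin t -> norm2 v = r.
Proof.
move=> r0 hx hy; rewrite /norm2 dot2E hx hy.
have -> : r * cos t * (r * cos t) + r * sin t * (r * sin t) = r ^+ 2 * (cos t ^+ 2 + sin t ^+ 2) by ring.
by rewrite cos2Dsin2 mulr1 sqrtr_sqr gtr0_norm.
Qed.

Lemma dot_ell t : exists2 r, 0 < r & dot (ell t) (ell (t + phi)) = r * cos (turn t) /\
  norm2 (ell t) * norm2 (ell (t + phi)) = r.
Proof.
have [r r0 [hx hy]] := ell_polar t; have [r' r'0 [hx' hy']] := ell_polar (t + phi).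
exists (r * r'); first by rewrite mulr_gt0.
rewrite (norm2_polar _ _ _ r0 (etrans (ell0 _) hx) (etrans (ell1 _) hy)).
rewrite (norm2_polar _ _ _ r'0 (etrans (ell0 _) hx') (etrans (ell1 _) hy')); split=> //.
rewrite dot2E !ell0 !ell1 hx hy hx' hy'.
have -> : turn t = (t + phi + tilt (t + phi)) - (t + tilt t) by rewrite /turn; ring.
by rewrite [in RHS]cosB; ring.
Qed.

Lemma angle_ell t s s' : s != 0 -> s' != 0 ->
  angle <[s *: ell t]> <[s' *: ell (t + phi)]> = step t.
Proof.
move=> s0 s'0; rewrite angle_line ?scaler_eq0 ?negb_or ?s0 ?s'0 ?ell_neq0//.
have [r r0 [hd hn]] := dot_ell t.
rewrite dotZ !norm2Z mulrACA hn hd !normrM (gtr0_norm r0).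
have -> : `|s| * `|s'| * (r * `|cos (turn t)|) / (`|s| * `|s'| * r) = `|cos (turn t)|.
  by field; rewrite !normr_eq0 s0 s'0 gt_eqF.
rewrite /step.
have /andP[t0 tp] := turn_itv t; have pg := pi_gt0 R.
have [h|h] := leP (turn t) (pi / 2).
  rewrite ger0_norm; last by apply: cos_ge0_pihalf; apply/andP; split; lra.
  rewrite cosK ?in_itv/= ?(ltW t0) ?(ltW tp)// ger0_norm; lra.
have -> : `|cos (turn t)| = cos (pi - turn t).
  rewrite cosB cospi sinpi mul0r addr0 mulN1r ler0_norm// -oppr_ge0.
  have -> : - cos (turn t) = cos (pi - turn t) by rewrite cosB cospi sinpi mul0r addr0 mulN1r.
  by apply: cos_ge0_pihalf; apply/andP; split; lra.
rewrite cosK ?in_itv/=; last by apply/andP; split; lra.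
rewrite ltr0_norm; lra.
Qed.

Lemma stepDpi t n : step (t + pi *+ n) = step t.
Proof. by rewrite /step /turn (addrAC t) !tiltDpi. Qed.

Lemma step_lipschitz : exists2 B, 0 <= B &
  forall x y, `|step x - step y| <= B * `|x - y|.
Proof.
have [B B0 HB] := tilt_lipschitz; exists (B + B) => [|x y]; first by rewrite addr_ge0.
have -> : step x - step y = `|pi / 2 - turn y| - `|pi / 2 - turn x| by rewrite /step; ring.
apply: le_trans (ler_dist_dist _ _) _.
have -> : pi / 2 - turn y - (pi / 2 - turn x) =
  (tilt (x + phi) - tilt (y + phi)) - (tilt x - tilt y) by rewrite /turn; ring.
apply: le_trans (ler_normB _ _) _; rewrite mulrDl lerD//.
by have := HB (x + phi) (y + phi); rewrite opprD addrACA subrr addr0.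
Qed.

Lemma step_itv t : 0 <= step t <= pi / 2.
Proof.
have /andP[t0 tp] := turn_itv t; have pg := pi_gt0 R; rewrite /step.
by have [h|h] := leP (turn t) (pi / 2); [rewrite ger0_norm | rewrite ltr0_norm]; try lra;
  apply/andP; split; lra.
Qed.

(** The sum telescopes, as [turn] is [phi] plus an increment of [tilt]. *)
Lemma sum_turn t n :
  `|\sum_(i < n) turn (t + i%:R * phi) - n%:R * phi| <= pi.
Proof.
have -> : \sum_(i < n) turn (t + i%:R * phi) - n%:R * phi = tilt (t + n%:R * phi) - tilt t.
  elim: n => [|n IH]; first by rewrite big_ord0 !mul0r addr0 !subrr.
  rewrite big_ord_recr/=; apply/eqP; rewrite subr_eq -subr_eq0; apply/eqP.
  move/eqP: IH; rewrite subr_eq => /eqP ->; rewrite /turn.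
  have -> : t + n%:R * phi + phi = t + n.+1%:R * phi by rewrite -natr1; ring.
  by rewrite -natr1; ring.
have /andP[h1 h2] := tilt_itv t; have /andP[h3 h4] := tilt_itv (t + n%:R * phi).
by rewrite ler_norml; apply/andP; split; lra.
Qed.

(** The positions of the multiples of [phi] modulo [pi], up to [pi / M], take
    finitely many values, all reached before some time [K]. *)
Lemma almost_return M : (0 < M)%N -> exists K, forall k, exists i, exists q r x y,
  [/\ (i <= K)%N, k%:R * phi = x + pi *+ q, i%:R * phi = y + pi *+ r &
      `|x - y| <= pi / M%:R].
Proof.
move=> M0; have /andP[f0 _] := phi_itv; have pg := pi_gt0 R.
have Mg : 0 < M%:R :> R by rewrite ltr0n.
(* x k is the residue of k phi modulo pi, and bin k the index of the one of
   M intervals of length pi / M that contains it *)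
pose q k := Num.truncn (k%:R * phi / pi).
pose x k := k%:R * phi - pi *+ q k.
have xE k : 0 <= x k < pi.
  have : 0 <= k%:R * phi / pi by rewrite !mulr_ge0 ?invr_ge0 ?(ltW f0) ?(ltW pg).
  move=> /truncn_itv; rewrite ler_pdivlMr// ltr_pdivrMr// -/(q k) /x -mulr_natl -natr1.
  move=> /andP[h1 h2]; apply/andP; split; lra.
pose bin k := Num.truncn (x k / pi * M%:R).
have binE k : (bin k)%:R <= x k / pi * M%:R < (bin k).+1%:R.
  apply: truncn_itv; rewrite !mulr_ge0 ?invr_ge0 ?(ltW pg)//; by case/andP: (xE k).
have binM k : (bin k < M)%N.
  rewrite -(ltr_nat R); have /andP[h _] := binE k; apply: le_lt_trans h _.
  rewrite gtr_pMl// ltr_pdivrMr// mul1r; by case/andP: (xE k).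
have rep (j : 'I_M) : exists i, forall k, bin k = j -> bin i = j.
  have [[k hk]|h] := pselect (exists k, bin k = j); first by exists k.
  by exists 0%N => k hk; case: h; exists k.
have [g Hg] := choice rep.
exists (\max_(j < M) g j) => k; pose j := Ordinal (binM k); exists (g j).
exists (q k), (q (g j)), (x k), (x (g j)); split.
- exact: leq_bigmax.
- by rewrite /x subrK.
- by rewrite /x subrK.
- have e : bin (g j) = bin k by apply: (Hg j k).
  have /andP[h1 h2] := binE k; have := binE (g j); rewrite e => /andP[h3 h4].
  have -> : x k - x (g j) = (x k / pi * M%:R - x (g j) / pi * M%:R) * (pi / M%:R).
    move: (x k) (x (g j)) (pi : R) pg => y z P P0.
    by field; rewrite !gt_eqF.
  rewrite normrM [X in _ * X]gtr0_norm ?divr_gt0// ger_pMl ?divr_gt0//.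
  rewrite -natr1 in h2 h4; rewrite ler_norml; apply/andP; split; lra.
Qed.

(** Mean angles depend little on the starting time: time [k] can be replaced by
    a bounded time [i] up to a small rotation, and [i] by [0] up to [i]
    terms. *)
Lemma sum_step_shift (e : R) : 0 < e -> exists N, forall n k t, (N <= n)%N ->
  `|\sum_(i < n) step (t + (k + i)%:R * phi) - \sum_(i < n) step (t + i%:R * phi)|
    <= e * n%:R.
Proof.
move=> e0; have pg := pi_gt0 R; have [B B0 HB] := step_lipschitz.
pose S n t := \sum_(i < n) step (t + i%:R * phi).
have SL n x y : `|S n x - S n y| <= B * `|x - y| * n%:R.
  rewrite /S -sumrB (le_trans (ler_norm_sum _ _ _))//.
  rewrite mulr_natr -[n in leRHS]card_ord -sumr_const ler_sum// => i _.
  have -> : x - y = x + i%:R * phi - (y + i%:R * phi) by ring.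
  exact: HB.
have Spi n t q : S n (t + pi *+ q) = S n t.
  by apply: eq_bigr => i _; rewrite addrAC stepDpi.
have Ssh n t i : `|S n (t + i%:R * phi) - S n t| <= i%:R * (pi / 2).
  elim: i => [|i IH]; first by rewrite mul0r addr0 subrr normr0 mul0r.
  have -> : S n (t + i.+1%:R * phi) - S n t =
      (S n (t + i.+1%:R * phi) - S n (t + i%:R * phi)) + (S n (t + i%:R * phi) - S n t) by ring.
  apply: le_trans (ler_normD _ _) _; rewrite -natr1 [leRHS]mulrDl mul1r addrC lerD//.
  set z := t + i%:R * phi; have -> : t + (i%:R + 1) * phi = z + phi by rewrite /z; ring.
  have -> : S n (z + phi) - S n z = step (z + n%:R * phi) - step z.
    have h1 : S n.+1 z = S n z + step (z + n%:R * phi) by rewrite /S big_ord_recr.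
    have h2 : S n.+1 z = step z + S n (z + phi).
      rewrite /S big_ord_recl mul0r addr0; congr (_ + _); apply: eq_bigr => j _.
      by congr step; rewrite lift0 -natr1; ring.
    by move/eqP: h1; rewrite h2 -subr_eq0 => /eqP h; apply/eqP; rewrite -subr_eq0 -h; apply/eqP; ring.
  have /andP[h1 h2] := step_itv (z + n%:R * phi); have /andP[h3 h4] := step_itv z.
  by rewrite ler_norml; apply/andP; split; lra.
pose M := (Num.truncn (2 * B * pi / e)).+1.
have Mg : 0 < M%:R :> R by rewrite ltr0n.
have [K HK] := almost_return M isT.
exists (Num.truncn (2 * K%:R * (pi / 2) / e)).+1 => n k t Nn.
have [i [q [r [x [y [iK kE iE xy]]]]]] := HK k.
have -> : \sum_(i < n) step (t + (k + i)%:R * phi) = S n (t + x).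
  rewrite -(Spi n (t + x) q) -addrA -kE; apply: eq_bigr => j _; congr step.
  by rewrite natrD; ring.
rewrite -/(S n t).
have -> : S n (t + x) - S n t = (S n (t + x) - S n (t + y)) + (S n (t + i%:R * phi) - S n t).
  have -> : S n (t + i%:R * phi) = S n (t + y) by rewrite iE addrA Spi.
  ring.
apply: le_trans (ler_normD _ _) _.
have h1 : `|S n (t + x) - S n (t + y)| <= e / 2 * n%:R.
  apply: le_trans (SL _ _ _) _; rewrite ler_wpM2r// opprD addrACA subrr add0r.
  apply: (@le_trans _ _ (B * (pi / M%:R))); first by rewrite ler_wpM2l.
  rewrite mulrA ler_pdivrMr//.
  have : 2 * B * pi / e < M%:R by exact: truncnS_gt.
  rewrite ltr_pdivrMr// => h; lra.
have h2 : `|S n (t + i%:R * phi) - S n t| <= e / 2 * n%:R.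
  apply: le_trans (Ssh _ _ _) _.
  have : 2 * K%:R * (pi / 2) / e < n%:R by apply: (lt_le_trans (truncnS_gt _)); rewrite ler_nat.
  rewrite ltr_pdivrMr// => h.
  have : i%:R <= K%:R :> R by rewrite ler_nat.
  nra.
by rewrite [e in leRHS]splitr mulrDl lerD.
Qed.

End Ellipse.

(** * Identification of means and suprema *)

Section Means.
Variables (R : realType) (A : 'M[R]_2).
Implicit Types (V : {vspace 'cV[R]_2}) (m : {vspace 'cV[R]_2} -> R).

Lemma uniform_mean_dist m V (x B : R) : uniform_mean R A m -> Gr12 V ->
  (forall n, `|angle_sum A 0 n V - n%:R * x| <= B) -> m V = x.
Proof.
move=> um GV H; apply/eqP; rewrite -subr_eq0 -normr_eq0 -[_ == 0]negbK.
apply/negP => d0; have {}d0 : 0 < `|m V - x| by rewrite lt_def d0 normr_ge0.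
set e := `|_| in d0.
have [N HN] := um (e / 2) (divr_gt0 d0 (ltr0n _ 2)).
pose n := (maxn N (Num.truncn (2 * B / e))).+1.
have n0 : 0 < n%:R :> R by rewrite ltr0n.
have h1 : `|n%:R^-1 * angle_sum A 0 n V - m V| <= e / 2.
  by apply: HN => //; rewrite ltnW// ltnS leq_maxl.
have h2 : 2 * B < e * n%:R.
  rewrite [ltRHS]mulrC -ltr_pdivrMr//; apply: lt_le_trans (truncnS_gt _) _.
  by rewrite ler_nat ltnS leq_maxr.
have h3 : `|n%:R^-1 * angle_sum A 0 n V - x| <= B / n%:R.
  rewrite ler_pdivlMr// -[X in _ * X](gtr0_norm n0) -normrM mulrBl mulrAC mulVf ?gt_eqF// mul1r.
  by rewrite mulrC; exact: H.
have : e <= B / n%:R + e / 2.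
  have E : m V - x = (n%:R^-1 * angle_sum A 0 n V - x) -
    (n%:R^-1 * angle_sum A 0 n V - m V) by ring.
  by rewrite {1}/e E (le_trans (ler_normB _ _))// lerD.
have : B / n%:R < e / 2 by rewrite ltr_pdivrMr//; lra.
lra.
Qed.

Lemma uniform_mean_le m V (x B : R) : uniform_mean R A m -> Gr12 V ->
  (forall n, angle_sum A 0 n V <= n%:R * x + B) -> m V <= x.
Proof.
move=> um GV H; rewrite leNgt; apply/negP => xm.
set e := m V - x; have e0 : 0 < e by rewrite subr_gt0.
have [N HN] := um (e / 2) (divr_gt0 e0 (ltr0n _ 2)).
pose n := (maxn N (Num.truncn (2 * B / e))).+1.
have n0 : 0 < n%:R :> R by rewrite ltr0n.
have h1 : `|n%:R^-1 * angle_sum A 0 n V - m V| <= e / 2.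
  by apply: HN => //; rewrite ltnW// ltnS leq_maxl.
have h2 : 2 * B < e * n%:R.
  rewrite [ltRHS]mulrC -ltr_pdivrMr//; apply: lt_le_trans (truncnS_gt _) _.
  by rewrite ler_nat ltnS leq_maxr.
have h3 : n%:R^-1 * angle_sum A 0 n V <= x + B / n%:R.
  by rewrite mulrC ler_pdivrMr// mulrDl divfK ?gt_eqF// mulrC; exact: H.
have : B / n%:R < e / 2 by rewrite ltr_pdivrMr//; lra.
move: h1; rewrite ler_distl => /andP[h1 _] h4; rewrite /e in h1 h4; lra.
Qed.

Lemma supV_const m c : (forall V, Gr12 V -> m V = c) -> supV m = c.
Proof.
move=> mc; have [V0 GV0] := Gr12_nonempty R.
rewrite /supV (_ : [set m V | V in _] = [set c]) ?sup1//.
by apply/seteqP; split=> [_ [V GV <-]|_ ->]; [exact: mc | exists V0 => //; exact: mc].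
Qed.

Lemma supV_le m c : (forall V, Gr12 V -> m V <= c) -> supV m <= c.
Proof.
move=> mc; have [V0 GV0] := Gr12_nonempty R.
by apply: ge_sup => [|_ [V GV <-]]; [exists (m V0), V0 | exact: mc].
Qed.

End Means.

(** * Matrices with nonreal eigenvalues *)

Section Elliptic.
Variable R : realType.
Implicit Type A : 'M[R]_2.

(** [A] is conjugate to [c] times the rotation by [phi], by a symmetric matrix;
    the sign of [c] is chosen so that [phi] lies in [(0, pi)]. *)
Lemma elliptic_form A :
  (A 0 0 + A 1 1) ^+ 2 < 4 * (A 0 0 * A 1 1 - A 0 1 * A 1 0) ->
  exists a b p c phi, [/\ 0 < a, p ^+ 2 < a * b, c != 0, 0 < phi < pi &
    [/\ c ^+ 2 = A 0 0 * A 1 1 - A 0 1 * A 1 0,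
        2 * (c * cos phi) = A 0 0 + A 1 1 &
        forall t, A *m ell R a b p t = c *: ell R a b p (t + phi)]].
Proof.
set d := A 0 0 * A 1 1 - A 0 1 * A 1 0; set x := (A 0 0 + A 1 1) / 2 => disc.
have trE : A 0 0 + A 1 1 = 2 * x by rewrite /x mulrC divfK.
have xd : x ^+ 2 < d by move: disc; rewrite trE exprMn; lra.
have A11 : A 1 1 = 2 * x - A 0 0 by rewrite -trE addrC addKr.
have hbc : A 0 1 * A 1 0 = x ^+ 2 - d - (A 0 0 - x) ^+ 2 by rewrite /d A11; ring.
have c0 : A 1 0 != 0.
  apply: contraTneq xd => c0; rewrite -leNgt; rewrite c0 mulr0 in hbc.
  have := sqr_ge0 (A 0 0 - x); lra.
have d0 : 0 < d by exact: le_lt_trans (sqr_ge0 x) xd.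
pose s := Num.sg (A 1 0); pose w := Num.sqrt (d - x ^+ 2); pose r := Num.sqrt d.
have w0 : 0 < w by rewrite sqrtr_gt0 subr_gt0.
have r0 : 0 < r by rewrite sqrtr_gt0.
have w2 : w ^+ 2 = d - x ^+ 2 by rewrite sqr_sqrtr// subr_ge0 ltW.
have r2 : r ^+ 2 = d by rewrite sqr_sqrtr// ltW.
have s2 : s ^+ 2 = 1 by rewrite sqr_sg c0.
have s0 : s != 0 by rewrite sgr_eq0.
pose y := s * w; pose c := s * r.
have y0 : y != 0 by rewrite mulf_neq0// gt_eqF.
have y2 : y ^+ 2 = d - x ^+ 2 by rewrite exprMn s2 mul1r.
(* A = x + y K, where K = [[kp, kq], [ks, - kp]] has square - 1.  With J the
   rotation by pi / 2, the symmetric matrix P = 1 - K J satisfies K P = P J; it is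
   positive definite when ks > 0, whence the choice of the sign s of y. *)
pose kp := (A 0 0 - x) / y; pose kq := A 0 1 / y; pose ks := A 1 0 / y.
have kpE : A 0 0 = x + y * kp by rewrite /kp mulrC divfK// addrC subrK.
have kqE : A 0 1 = y * kq by rewrite /kq mulrC divfK.
have ksE : A 1 0 = y * ks by rewrite /ks mulrC divfK.
have kk : kq * ks = -1 - kp ^+ 2.
  have : y ^+ 2 * (kq * ks) = y ^+ 2 * (-1 - kp ^+ 2).
    transitivity (A 0 1 * A 1 0); first by rewrite kqE ksE; ring.
    rewrite hbc; have -> : A 0 0 - x = y * kp by rewrite kpE; ring.
    by rewrite mulrBr y2; ring: y2.
  by apply: mulfI; rewrite expf_neq0.
have ks0 : 0 < ks.
  have sE : s^-1 = s by apply: (mulfI s0); rewrite divff// -expr2 s2.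
  rewrite /ks /y invfM sE mulrA [A 1 0 * s]mulrC -normrEsg divr_gt0//.
  by rewrite normr_gt0.
have kq0 : kq < 0 by rewrite -(pmulr_llt0 _ ks0) kk; have := sqr_ge0 kp; lra.
have cc0 : c != 0 by rewrite mulf_neq0// gt_eqF.
have c2 : c ^+ 2 = d by rewrite exprMn s2 mul1r.
have xc2 : (x / c) ^+ 2 < 1 by rewrite expr_div_n c2 ltr_pdivrMr// mul1r.
have xc : -1 < x / c < 1 by rewrite -ltr_norml -ltr_sqr ?nnegrE// real_normK ?num_real// expr1n.
have xc' : -1 <= x / c <= 1 by case/andP: xc => h1 h2; rewrite !ltW.
have cphi : c * cos (acos (x / c)) = x by rewrite acosK ?in_itv//= mulrC divfK.
have sphi : c * sin (acos (x / c)) = y.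
  rewrite sin_acos//; have -> : 1 - (x / c) ^+ 2 = (w / r) ^+ 2.
    by rewrite (expr_div_n x c) (expr_div_n w r) c2 r2 w2 mulrBl divff ?gt_eqF.
  rewrite sqrtr_sqr ger0_norm ?divr_ge0 ?(ltW w0) ?(ltW r0)// /c /y.
  by field; rewrite gt_eqF.
exists (1 - kq), (1 + ks), kp, c, (acos (x / c)); split => //.
- by rewrite subr_gt0 (lt_trans kq0).
- have -> : (1 - kq) * (1 + ks) = 1 + ks - kq - kq * ks by ring.
  rewrite kk; lra.
- by case/andP: xc => h1 h2; rewrite acos_gt0 ?acos_ltpi// ?h1 ?h2 ?ltW.
split => // [|t]; first by rewrite cphi trE.
apply: colvec2P; rewrite [RHS]mxE mulmx2E !(ell0, ell1) sinD cosD.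
  transitivity ((1 - kq) * (cos t * (c * cos (acos (x / c))) - sin t * (c * sin (acos (x / c)))) +
    kp * (sin t * (c * cos (acos (x / c))) + cos t * (c * sin (acos (x / c))))); last by ring.
  rewrite cphi sphi kqE kpE; ring: kk.
transitivity (kp * (cos t * (c * cos (acos (x / c))) - sin t * (c * sin (acos (x / c)))) +
  (1 + ks) * (sin t * (c * cos (acos (x / c))) + cos t * (c * sin (acos (x / c))))); last by ring.
rewrite cphi sphi A11 ksE kpE; ring: kk.
Qed.

(** The last two cases occur when every step turns by at most, respectively at
    least, a right angle. *)
Lemma elliptic_mean A a b p c phi : 0 < a -> p ^+ 2 < a * b -> c != 0 ->
  0 < phi < pi -> (forall t, A *m ell R a b p t = c *: ell R a b p (t + phi)) ->
  exists m, [/\ uniform_mean R A m,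
    forall V, Gr12 V -> m V <= Num.min phi (pi - phi),
    (forall t, turn R a b p phi t <= pi / 2) -> forall V, Gr12 V -> m V = phi &
    (forall t, pi / 2 <= turn R a b p phi t) -> forall V, Gr12 V -> m V = pi - phi].
Proof.
move=> a0 pab c0 fI AE; have pg := pi_gt0 R.
pose f := step R a b p phi.
have powE k s t : A ^+ k *m (s *: ell R a b p t) = (c ^+ k * s) *: ell R a b p (t + k%:R * phi).
  elim: k => [|k IH]; first by rewrite !expr0 mul1mx mul1r mul0r addr0.
  rewrite exprS -mulmxA IH -scalemxAr AE scalerA exprS -natr1; congr (_ *: ell R a b p _); ring.
have sumE k n s t : s != 0 -> angle_sum A k n <[s *: ell R a b p t]> =
    \sum_(i < n) f (t + (k + i)%:R * phi).
  move=> s0; rewrite angle_sum_line; apply: eq_bigr => i _.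
  rewrite powE -scalemxAr AE scalerA angle_ell// !mulf_neq0// expf_neq0//.
have line V : Gr12 V -> exists s t, s != 0 /\ V = <[s *: ell R a b p t]>%VS.
  by move=> /Gr12_line[v /(ell_onto _ _ _ _ pab)[s [t [s0 ->]]] ->]; exists s, t.
have [m um] : exists m, uniform_mean R A m.
  apply: shift_uniform_mean => e e0.
  have [N HN] := sum_step_shift _ _ _ _ a0 pab _ fI _ e0.
  exists N => n k V Nn /line[s [t [s0 ->]]].
  by rewrite !sumE//; exact: HN.
have tI t := turn_itv _ _ _ _ a0 pab _ fI t.
have sT n t := sum_turn R a b p phi t n.
have fle t : f t <= turn R a b p phi t /\ f t <= pi - turn R a b p phi t.
  rewrite /f /step.
  by have [h|h] := leP (turn R a b p phi t) (pi / 2);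
    [rewrite ger0_norm | rewrite ltr0_norm]; try lra; split; lra.
have sum_pi n t : \sum_(i < n) (pi - turn R a b p phi (t + i%:R * phi)) =
    n%:R * pi - \sum_(i < n) turn R a b p phi (t + i%:R * phi).
  by rewrite sumrB sumr_const card_ord mulr_natl.
exists m; split => //.
- move=> V GV; have [s [t [s0 VE]]] := line V GV; rewrite le_min; apply/andP; split.
    apply: (uniform_mean_le _ _ _ _ _ pi um GV) => n.
    rewrite VE sumE//; have := sT n t; rewrite ler_distl => /andP[_ h].
    by apply: le_trans h; apply: ler_sum => i _; rewrite add0n; case: (fle (t + i%:R * phi)).
  apply: (uniform_mean_le _ _ _ _ _ pi um GV) => n.
  rewrite VE sumE//; have := sT n t; rewrite ler_distl => /andP[h _].
  apply: (@le_trans _ _ (\sum_(i < n) (pi - turn R a b p phi (t + i%:R * phi)))).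
    by apply: ler_sum => i _; rewrite add0n; case: (fle (t + i%:R * phi)).
  rewrite sum_pi mulrBr; lra.
- move=> T V GV; have [s [t [s0 VE]]] := line V GV.
  apply: (uniform_mean_dist _ _ _ _ _ pi um GV) => n; rewrite VE sumE//.
  apply: le_trans (sT n t); rewrite le_eqVlt; apply/orP; left; apply/eqP.
  congr `|_ - _|; apply: eq_bigr => i _; rewrite add0n /f /step.
  by rewrite ger0_norm ?subr_ge0//; ring.
- move=> T V GV; have [s [t [s0 VE]]] := line V GV.
  apply: (uniform_mean_dist _ _ _ _ _ pi um GV) => n; rewrite VE sumE//.
  apply: le_trans (sT n t); rewrite le_eqVlt; apply/orP; left; apply/eqP.
  rewrite -[RHS]normrN; congr `|_|.
  transitivity (\sum_(i < n) (pi - turn R a b p phi (t + i%:R * phi)) - n%:R * (pi - phi)).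
    congr (_ - _); apply: eq_bigr => i _; rewrite add0n /f /step.
    by rewrite ler0_norm ?subr_le0//; lra.
  by rewrite sum_pi; ring.
Qed.

(** The determinant of the symmetric part of [A] is
    [det A - (A 0 1 - A 1 0) ^ 2 / 4]; the hypothesis makes it nonnegative. *)
Lemma semidefinite_of_skew A :
  (A 0 1 - A 1 0) ^+ 2 <= 4 * (A 0 0 * A 1 1 - A 0 1 * A 1 0) ->
  (forall v, 0 <= dot v (A *m v)) \/ (forall v, dot v (A *m v) <= 0).
Proof.
move=> sk; pose q v := dot v (A *m v).
set u := (A 0 1 + A 1 0) / 2.
have uE : A 0 1 + A 1 0 = 2 * u by rewrite /u mulrC divfK.
have hu : u ^+ 2 <= A 0 0 * A 1 1.
  have : (A 0 1 - A 1 0) ^+ 2 = (2 * u) ^+ 2 - 4 * (A 0 1 * A 1 0) by rewrite -uE; ring.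
  move=> e; rewrite e exprMn in sk; lra.
have qE v : q v = A 0 0 * v 0 0 ^+ 2 + 2 * u * (v 0 0 * v 1 0) + A 1 1 * v 1 0 ^+ 2.
  by rewrite /q dot2E !mulmx2E -uE; ring.
have q0 v : 0 <= A 0 0 * q v.
  rewrite qE; have -> : A 0 0 * (A 0 0 * v 0 0 ^+ 2 + 2 * u * (v 0 0 * v 1 0) + A 1 1 * v 1 0 ^+ 2) =
    (A 0 0 * v 0 0 + u * v 1 0) ^+ 2 + (A 0 0 * A 1 1 - u ^+ 2) * v 1 0 ^+ 2 by ring.
  by apply: addr_ge0; rewrite ?sqr_ge0// mulr_ge0 ?sqr_ge0// subr_ge0.
have q1 v : 0 <= A 1 1 * q v.
  rewrite qE; have -> : A 1 1 * (A 0 0 * v 0 0 ^+ 2 + 2 * u * (v 0 0 * v 1 0) + A 1 1 * v 1 0 ^+ 2) =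
    (u * v 0 0 + A 1 1 * v 1 0) ^+ 2 + (A 0 0 * A 1 1 - u ^+ 2) * v 0 0 ^+ 2 by ring.
  by apply: addr_ge0; rewrite ?sqr_ge0// mulr_ge0 ?sqr_ge0// subr_ge0.
have [t0|t0|t0] := ltgtP (A 0 0 + A 1 1) 0.
- right=> v; rewrite -/(q v) -(nmulr_rge0 _ t0) mulrDl addr_ge0//.
- left=> v; rewrite -/(q v) -(pmulr_rge0 _ t0) mulrDl addr_ge0//.
- left=> v; rewrite -/(q v) qE.
  have e : A 1 1 = - A 0 0 by apply/eqP; rewrite -addr_eq0 addrC t0.
  rewrite e mulrN -expr2 in hu.
  have a2 : A 0 0 = 0.
    apply/eqP; rewrite -sqrf_eq0; apply/eqP; have := sqr_ge0 (A 0 0); have := sqr_ge0 u; lra.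
  have u2 : u = 0.
    apply/eqP; rewrite -sqrf_eq0; apply/eqP; rewrite a2 in hu; have := sqr_ge0 u; lra.
  by rewrite e a2 u2 oppr0 !(mul0r, mulr0, addr0).
Qed.

Lemma spectral_norm_skew A : spectral_norm (A - A^T) = `|A 0 1 - A 1 0|.
Proof.
pose w := A 0 1 - A 1 0.
have dE v : dot ((A - A^T) *m v) ((A - A^T) *m v) = w ^+ 2 * dot v v.
  by rewrite !dot2E !mulmx2E !mxE /w; ring.
have nE v : norm2 v = 1 -> norm2 ((A - A^T) *m v) = `|w|.
  move=> v1; rewrite {1}/norm2 dE sqrtrM ?sqr_ge0// sqrtr_sqr.
  by rewrite -/(norm2 v) v1 mulr1.
rewrite /spectral_norm (_ : [set norm2 _ | v in _] = [set `|w|]) ?sup1//.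
apply/seteqP; split=> [_ [v v1 <-]|_ ->]; first exact: nE.
pose e1 : 'cV[R]_2 := \col_i (i == 0)%:R.
have n1 : norm2 e1 = 1 by rewrite /norm2 dot2E !mxE/= mulr1 mulr0 addr0 sqrtr1.
by exists e1 => //; exact: nE.
Qed.

Lemma skewness_le1 A lam : spectrum A = [set lam; conjc lam] -> 0 < cabs lam ->
  skewness A <= 1 -> (A 0 1 - A 1 0) ^+ 2 <= 4 * cabs lam ^+ 2.
Proof.
move=> sA l0; rewrite /skewness spectral_norm_skew.
have -> : spectral_radius A = cabs lam.
  rewrite /spectral_radius sA (_ : [set cabs l | l in _] = [set cabs lam]) ?sup1//.
  apply/seteqP; split=> [_ [l [->|->] <-]//|_ ->]; last by exists lam => //; left.
  by case: lam {sA l0} => x y; rewrite /cabs/= sqrrN.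
rewrite ler_pdivrMl ?mulr_gt0// mulr1 => h.
have -> : 4 * cabs lam ^+ 2 = (2 * cabs lam) ^+ 2 by ring.
by rewrite -[leLHS]real_normK ?num_real// ler_sqr ?nnegrE// mulr_ge0 ?ltW.
Qed.

End Elliptic.

(** * Spectrum and argument *)

Section Spectrum.
Variable R : realType.
Implicit Type A : 'M[R]_2.
Local Open Scope complex_scope.

(** Real and imaginary parts of the characteristic equation. *)
Lemma spectrum_eqns A (x y : R) : spectrum A (x +i* y) <->
  x ^+ 2 - y ^+ 2 - (A 0 0 + A 1 1) * x + (A 0 0 * A 1 1 - A 0 1 * A 1 0) = 0
  /\ y * (2 * x - (A 0 0 + A 1 1)) = 0.
Proof.
set X := (X in X = 0 /\ _); set Y := (Y in _ /\ Y = 0).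
have E : (char_poly (map_mx (real_complex R) A)).[x +i* y] = X +i* Y.
  rewrite /char_poly det_mx2 !mxE/= !mulr1n !mulr0n !hornerE /X /Y.
  simpc; apply/eqP; rewrite eq_complex/=; apply/andP; split; apply/eqP; ring.
rewrite /spectrum/= eigenvalue_root_char /root E eq_complex/=.
by split=> [/andP[/eqP h1 /eqP h2]|[-> ->]]; rewrite ?eqxx.
Qed.

Lemma norm_carg (z : R[i]) : z != 0 -> `|carg z| = acos (complex.Re z / cabs z).
Proof.
move=> z0; have h : -1 <= complex.Re z / cabs z <= 1.
  apply: normr_div_sqrt_le1; case: z z0 => x y; rewrite eq_complex/= => z0.
  by rewrite paddr_eq0 ?sqr_ge0// !expf_eq0.
have a0 := acos_ge0 h; rewrite /carg; case: ifP => _; last rewrite normrN.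
  by rewrite ger0_norm.
by rewrite ger0_norm.
Qed.

End Spectrum.

(** * Traceless matrices *)

Section Period2.
Variables (R : realType) (A : 'M[R]_2).
Hypotheses (uA : A \in unitmx) (tA : A 0 0 + A 1 1 = 0).

Let d := A 0 0 * A 1 1 - A 0 1 * A 1 0.

Lemma traceless_sqr (v : 'cV[R]_2) : A *m (A *m v) = - d *: v.
Proof.
have e : A 1 1 = - A 0 0 by apply/eqP; rewrite -addr_eq0 addrC tA.
by apply: colvec2P; rewrite [RHS]mxE !mulmx2E /d e; ring.
Qed.

Lemma traceless_mean : uniform_mean R A (fun V => angle V (mx_image A V)).
Proof.
have d0 : d != 0 by move: uA; rewrite unitmxE det_mx2 unitfE.
have inv (v : 'cV[R]_2) : v != 0 -> angle <[A *m v]> <[A *m (A *m v)]> = angle <[v]> <[A *m v]>.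
  move=> v0; have w0 := mulmx_unit_neq0 _ _ _ uA v0.
  rewrite traceless_sqr angle_line// ?scaler_eq0 ?negb_or ?oppr_eq0 ?d0// angle_line//.
  have -> : - d *: v = (- d) *: (1 *: v) by rewrite scale1r.
  have -> : dot (A *m v) (- d *: (1 *: v)) = - d * dot v (A *m v).
    by rewrite !dot2E !mxE; ring.
  rewrite scale1r norm2Z normrM normrN; congr acos.
  by field; rewrite normr_eq0 d0 !gt_eqF// norm2_gt0.
have invk (v : 'cV[R]_2) k : v != 0 ->
    angle <[A ^+ k *m v]> <[A *m (A ^+ k *m v)]> = angle <[v]> <[A *m v]>.
  move=> v0; elim: k => [|k IH]; first by rewrite expr0 mul1mx.
  by rewrite exprS -!mulmxA inv// exp_unit_neq0.
move=> e e0; exists 1%N => n k V n0 /Gr12_line[v v0 ->].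
rewrite angle_sum_line mx_image_line (eq_bigr (fun=> angle <[v]> <[A *m v]>)); last first.
  by move=> i _; exact: invk.
rewrite sumr_const card_ord -(mulr_natl (angle _ _)) mulrA mulVf ?pnatr_eq0 -?lt0n//.
by rewrite mul1r subrr normr0 ltW.
Qed.

Lemma traceless_orthogonal : exists2 v : 'cV[R]_2, v != 0 & dot v (A *m v) = 0.
Proof.
have e : A 1 1 = - A 0 0 by apply/eqP; rewrite -addr_eq0 addrC tA.
have [a0|a0] := eqVneq (A 0 0) 0.
  exists (\col_i (i == 0)%:R).
    by rewrite colvec2_eq0 !mxE/= oner_eq0.
  by rewrite dot2E !mulmx2E !mxE/= a0; ring.
pose u := A 0 1 + A 1 0; pose s := Num.sqrt (u ^+ 2 + 4 * A 0 0 ^+ 2).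
have s2 : s ^+ 2 = u ^+ 2 + 4 * A 0 0 ^+ 2.
  by rewrite sqr_sqrtr// addr_ge0 ?sqr_ge0// mulr_ge0 ?sqr_ge0.
exists (\col_i (if i == 0 then (s - u) / (2 * A 0 0) else 1)).
  by rewrite colvec2_eq0 !mxE/= oner_eq0 andbF.
rewrite dot2E !mulmx2E !mxE/= e.
set z := (s - u) / (2 * A 0 0).
have zE : 2 * A 0 0 * z = s - u by rewrite mulrC divfK// mulf_neq0// pnatr_eq0.
have : (2 * A 0 0 * z + u) ^+ 2 = u ^+ 2 + 4 * A 0 0 ^+ 2 by rewrite zE subrK.
move=> h; have : 4 * A 0 0 * (A 0 0 * z ^+ 2 + u * z - A 0 0) = 0.
  by transitivity ((2 * A 0 0 * z + u) ^+ 2 - (u ^+ 2 + 4 * A 0 0 ^+ 2)); [ring | rewrite h subrr].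
move/eqP; rewrite !mulf_eq0 (negbTE a0) pnatr_eq0/= => /eqP <-.
by rewrite /u; ring.
Qed.

Lemma traceless_supV : supV (fun V => angle V (mx_image A V)) = pi / 2.
Proof.
apply/eqP; rewrite eq_le; apply/andP; split.
  by apply: supV_le => V _; case/andP: (angle_itv _ V (mx_image A V)).
have [v v0 h] := traceless_orthogonal; have w0 := mulmx_unit_neq0 _ _ _ uA v0.
apply: ub_le_sup.
  by exists (pi / 2) => _ [V _ <-]; case/andP: (angle_itv _ V (mx_image A V)).
exists <[v]>%VS; first exact: line_Gr12.
by rewrite mx_image_line angle_line// h normr0 mul0r acos0.
Qed.

End Period2.

(** * The three cases *)

Section Summary.
Variables (R : realType) (A : 'M[R]_2).
Hypothesis uA : A \in unitmx.
Local Open Scope complex_scope.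

Let tr := A 0 0 + A 1 1.
Let dt := A 0 0 * A 1 1 - A 0 1 * A 1 0.

Lemma plusminus_spectrum_trace lam : 0 < lam ->
  spectrum A = [set (- lam)%:C; lam%:C] -> tr = 0 /\ dt = - lam ^+ 2.
Proof.
move=> l0 sA.
have /spectrum_eqns[h1 _] : spectrum A (lam +i* 0) by rewrite sA; right.
have /spectrum_eqns[h2 _] : spectrum A (- lam +i* 0) by rewrite sA; left.
rewrite -/tr -/dt in h1 h2.
have t0 : lam * tr = 0 by lra.
move/eqP: t0; rewrite mulf_eq0 gt_eqF//= => /eqP t0; split=> //.
rewrite t0 in h1; lra.
Qed.

Lemma traceless_spectrum : tr = 0 -> dt < 0 ->
  spectrum A = [set (- Num.sqrt (- dt))%:C; (Num.sqrt (- dt))%:C].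
Proof.
move=> t0 d0; set s := Num.sqrt (- dt).
have s0 : 0 < s by rewrite sqrtr_gt0 oppr_gt0.
have s2 : s ^+ 2 = - dt by rewrite sqr_sqrtr// oppr_ge0 ltW.
apply/seteqP; split=> [[x y] /spectrum_eqns|_ [->|->]].
- rewrite -/tr -/dt t0 => -[h1 /eqP]; rewrite subr0 !mulf_eq0 pnatr_eq0/= => /orP[|]/eqP xy0.
    have : (x - s) * (x + s) = 0 by rewrite xy0 in h1; lra.
    move/eqP; rewrite mulf_eq0 subr_eq0 addr_eq0 xy0 => /orP[|]/eqP ->; by [right | left].
  by exfalso; rewrite xy0 in h1; have := sqr_ge0 y; lra.
- by apply/spectrum_eqns; rewrite -/tr -/dt t0; split; lra.
- by apply/spectrum_eqns; rewrite -/tr -/dt t0; split; lra.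
Qed.

Lemma nonreal_spectrum_disc (x y : R) : y != 0 -> spectrum A (x +i* y) ->
  tr = 2 * x /\ dt = x ^+ 2 + y ^+ 2.
Proof.
move=> y0 /spectrum_eqns; rewrite -/tr -/dt => -[h1 /eqP].
rewrite mulf_eq0 (negbTE y0)/= subr_eq0 => /eqP h2; split=> //.
rewrite -h2 in h1; lra.
Qed.

Lemma neg_disc_nonreal : tr ^+ 2 < 4 * dt ->
  exists l, spectrum A l /\ complex.Im l != 0.
Proof.
move=> h; pose w := Num.sqrt (4 * dt - tr ^+ 2).
have w0 : 0 < w by rewrite sqrtr_gt0 subr_gt0.
have w2 : w ^+ 2 = 4 * dt - tr ^+ 2 by rewrite sqr_sqrtr// subr_ge0 ltW.
exists ((tr / 2) +i* (w / 2)); split; last by rewrite /= mulf_neq0 ?gt_eqF ?invr_gt0.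
apply/spectrum_eqns; rewrite -/tr -/dt expr_div_n [(w / 2) ^+ 2]expr_div_n w2.
by split; field.
Qed.

(** If the discriminant is nonnegative and the trace is not zero, the eigenvalues
    are equal or have distinct moduli. *)
Lemma real_bounded : 4 * dt <= tr ^+ 2 -> tr != 0 ->
  exists C, forall k n V, Gr12 V -> angle_sum A k n V <= C.
Proof.
rewrite le_eqVlt => /predU1P[h|h] t0.
  apply: (parabolic_bounded _ _ (tr / 2)) => //; first by rewrite -splitr.
  by apply: (@mulfI _ 4); rewrite ?pnatr_eq0// -/dt h; field.
pose w := Num.sqrt (tr ^+ 2 - 4 * dt).
have w0 : 0 < w by rewrite sqrtr_gt0 subr_gt0.
have w2 : w ^+ 2 = tr ^+ 2 - 4 * dt by rewrite sqr_sqrtr// subr_ge0 ltW.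
have dE : dt = (tr + w) / 2 * ((tr - w) / 2).
  transitivity ((tr ^+ 2 - w ^+ 2) / 4); first by rewrite w2; field.
  by field.
have [t1|t1] := ltP 0 tr.
  apply: (hyperbolic_bounded _ _ ((tr + w) / 2) ((tr - w) / 2)) => //.
    by rewrite -/tr; field.
  rewrite [ltRHS]gtr0_norm; last by rewrite divr_gt0// addr_gt0.
  by rewrite ltr_norml; apply/andP; split; lra.
have {}t1 : tr < 0 by rewrite lt_neqAle t0.
apply: (hyperbolic_bounded _ _ ((tr - w) / 2) ((tr + w) / 2)) => //.
- by rewrite -/tr; field.
- by rewrite -/dt dE mulrC.
rewrite [ltRHS]ltr0_norm; last by lra.
by rewrite ltr_norml; apply/andP; split; lra.
Qed.

Lemma elliptic_angular_value : tr ^+ 2 < 4 * dt -> exists m,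
  [/\ uniform_mean R A m
   & forall lam : R[i], complex.Im lam != 0 -> spectrum A = [set lam; conjc lam] ->
    supV m <= Num.min `|carg lam| (pi - `|carg lam|) /\
    (skewness A <= 1 -> supV m = Num.min `|carg lam| (pi - `|carg lam|)) ].
Proof.
move=> disc; have [a [b [p [c [phi [a0 pab c0 fI [c2 tE AE]]]]]]] := elliptic_form _ _ disc.
have pg := pi_gt0 R; have /andP[f0 fp] := fI.
have [m [um mle mphi mphi']] := elliptic_mean _ _ _ _ _ _ _ a0 pab c0 fI AE.
exists m; split=> // lam l0 sA.
have lam0 : lam != 0 by apply: contraNneq l0 => ->.
have [xE yE] : tr = 2 * complex.Re lam /\ dt = cabs lam ^+ 2.
  case: lam l0 sA {lam0} => x y /= l0 sA.
  have [|h1 h2] := nonreal_spectrum_disc x y l0; first by rewrite sA; left.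
  by rewrite h1 h2 /cabs/= sqr_sqrtr// addr_ge0 ?sqr_ge0.
have cl0 : 0 < cabs lam.
  rewrite lt_def sqrtr_ge0 andbT; apply: contraTneq disc => cl0.
  by rewrite yE cl0 expr0n mulr0 -leNgt sqr_ge0.
(* the eigenvalues are c (cos phi +/- i sin phi), and c has either sign *)
have argE : Num.min `|carg lam| (pi - `|carg lam|) = Num.min phi (pi - phi).
  have Re : c * cos phi = complex.Re lam by apply: (@mulfI _ 2); rewrite ?pnatr_eq0// tE -xE.
  have phiK : acos (cos phi) = phi by rewrite cosK// in_itv/= !ltW.
  have [cE|cE] : c = cabs lam \/ c = - cabs lam.
    have := c2; rewrite -/dt yE => /eqP; rewrite -subr_eq0 subr_sqr mulf_eq0 subr_eq0 addr_eq0.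
    by case/orP => /eqP ->; [left|right].
  - rewrite norm_carg// -Re cE mulrAC divff ?gt_eqF// mul1r phiK//.
  - rewrite norm_carg// -Re cE mulNr mulNr mulrAC divff ?gt_eqF// mul1r.
    rewrite acosN ?cos_geN1 ?cos_le1// phiK minC; congr Num.min; ring.
have smin : supV m <= Num.min phi (pi - phi) by exact: supV_le.
rewrite argE; split=> // sk; apply/eqP; rewrite eq_le smin/=.
have cos_ge x : 0 < x < pi -> 0 <= cos x -> x <= pi / 2.
  move=> /andP[x0 xp]; apply: contraTT; rewrite -!ltNge => h.
  have : cos x < cos (pi / 2) by rewrite ltr_cos// in_itv/=; apply/andP; split; lra.
  by rewrite cos_pihalf.
have cos_le x : 0 < x < pi -> cos x <= 0 -> pi / 2 <= x.
  move=> /andP[x0 xp]; apply: contraTT; rewrite -!ltNge => h.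
  by apply: cos_gt0_pihalf; apply/andP; split; lra.
have tI t := turn_itv _ _ _ _ a0 pab _ fI t.
have qE t : exists2 r, 0 < r &
    dot (ell R a b p t) (A *m ell R a b p t) = r * (c * cos (turn R a b p phi t)).
  have [r r0 [h _]] := dot_ell _ _ _ _ a0 pab phi t; exists r => //.
  by rewrite AE -[X in dot X _]scale1r dotZ h mul1r mulrCA.
have sk2 : (A 0 1 - A 1 0) ^+ 2 <= 4 * dt by rewrite yE; exact: skewness_le1.
have [T|T] : (forall t, turn R a b p phi t <= pi / 2) \/ (forall t, pi / 2 <= turn R a b p phi t).
  have [q|q] := semidefinite_of_skew _ _ sk2; have [cp|cn] := ltP 0 c.
  - left=> t; apply: cos_ge => //; have [r r0 h] := qE t.
    by have := q (ell R a b p t); rewrite h pmulr_rge0// pmulr_rge0.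
  - have {}cn : c < 0 by rewrite lt_neqAle c0.
    right=> t; apply: cos_le => //; have [r r0 h] := qE t.
    by have := q (ell R a b p t); rewrite h pmulr_rge0// nmulr_rge0.
  - right=> t; apply: cos_le => //; have [r r0 h] := qE t.
    by have := q (ell R a b p t); rewrite h pmulr_rle0// pmulr_rle0.
  - have {}cn : c < 0 by rewrite lt_neqAle c0.
    left=> t; apply: cos_ge => //; have [r r0 h] := qE t.
    by have := q (ell R a b p t); rewrite h pmulr_rle0// nmulr_rle0.
by rewrite (supV_const _ _ _ (mphi T)) ge_min lexx.
by rewrite (supV_const _ _ _ (mphi' T)) ge_min lexx orbT.
Qed.

End Summary.

Local Open Scope complex_scope.

Theorem proposition5p2 (R : realType) (A : 'M[R]_2) (hA : A \in unitmx) :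
  exists theta1 : R,
    [/\ [/\ uniform_outer_inf A = theta1, outer_inf A = theta1,
            outer_sup A = theta1 & uniform_outer_sup A = theta1],
        [/\ uniform_inner_inf A = theta1, inner_inf A = theta1,
            inner_sup A = theta1 & uniform_inner_sup A = theta1],
        (spectrum A `<=` [set l | complex.Im l = 0]) ->
          ((exists2 lam : R, 0 < lam &
              spectrum A = [set (- lam)%:C; lam%:C]) -> theta1 = pi / 2) /\
          (~ (exists2 lam : R, 0 < lam &
              spectrum A = [set (- lam)%:C; lam%:C]) -> theta1 = 0)
      & forall lam : R[i], complex.Im lam != 0 ->
          spectrum A = [set lam; conjc lam] ->
          theta1 <= Num.min `|carg lam| (pi - `|carg lam|) /\
          (skewness A <= 1 ->
             theta1 = Num.min `|carg lam| (pi - `|carg lam|)) ].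
Proof.
set tr := A 0 0 + A 1 1; set dt := A 0 0 * A 1 1 - A 0 1 * A 1 0.
have [disc|disc] := ltP (tr ^+ 2) (4 * dt).
  have [m [um mlam]] := elliptic_angular_value _ _ disc.
  have [v1 v2] := angular_values_eq _ _ _ um.
  exists (supV m); split=> // real; exfalso.
  by have [l [/real/= ->]] := neg_disc_nonreal _ _ disc; rewrite eqxx.
have nonreal lam : complex.Im lam != 0 -> spectrum A = [set lam; conjc lam] -> False.
  case: lam => x y /= y0 sA.
  have [|h1 h2] := nonreal_spectrum_disc _ A x y y0; first by rewrite sA; left.
  move: disc; rewrite /tr /dt h1 h2 leNgt => /negP; apply.
  have : 0 < y ^+ 2 by rewrite lt_def sqrf_eq0 y0 sqr_ge0.
  by rewrite exprMn; lra.
have [t0|t0] := eqVneq tr 0.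
  have d0 : dt < 0.
    rewrite lt_neqAle; apply/andP; split; last by move: disc; rewrite t0 expr0n/=; lra.
    by move: hA; rewrite unitmxE det_mx2 unitfE.
  have [v1 v2] := angular_values_eq _ _ _ (traceless_mean _ _ hA t0).
  exists (supV (fun V => angle V (mx_image A V))); split=> //.
    move=> _; split=> [_|no]; first exact: traceless_supV.
    case: no; exists (Num.sqrt (- dt)); first by rewrite sqrtr_gt0 oppr_gt0.
    exact: traceless_spectrum.
  by move=> lam /nonreal /[apply].
have [C HC] := real_bounded _ _ hA disc t0.
have [v1 v2] := angular_values_eq _ _ _ (bounded_uniform_mean _ _ _ HC).
exists (supV (fun=> 0)); split=> //.
  move=> _; split=> [[lam l0 /(plusminus_spectrum_trace _ _ _ l0)[h _]]|_].
    by rewrite /tr h eqxx in t0.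
  exact: supV_const.
by move=> lam /nonreal /[apply].
Qed.
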